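(* Let $X$ be a Banach $\mathbb{A}$-bimodule. The following assertions hold. (a) Let $A:D(A)\to X$ be a closed right linear operator with $D(A)$ dense in $X$. Assume that there are constants $M\in(1,\infty)$ and $w\in\mathbb{R}$ such that $(w,\infty)\subseteq\rho_{s}(A)$ and $$\|\mathsf{C}_\lambda(A)^n\|\le\frac{M}{(\lambda-w)^n}\qquad\forall n\in\mathbb{N},\ \forall\lambda>w.$$ Then $A$ is the generator of the strongly continuous semigroup $T:[0,\infty)\to\mathscr{L}^{r}(X)$ defined by $$T(t)x=\lim_{n\to\infty}e^{tA_n}x,\quad x\in X,\qquad\text{where }A_n:=nA\,\mathsf{C}_n(A)\in\mathscr{L}^{r}(X).$$ Moreover, $\|T(t)\|\le Me^{wt}$ for all $t\ge0$. (b) Let $T:[0,\infty)\to\mathscr{L}^{r}(X)$ be a strongly continuous semigroup. Then there are constants $M\in(1,\infty)$ and $w\in\mathbb{R}$ such that $\|T(t)\|\le Me^{tw}$ for every $t\ge0$. Moreover the generator $A$ of $T$ is closed, $D(A)$ is dense, $(w,\infty)\subseteq\rho_{s}(A)$ and $\|\mathsf{C}_\lambda(A)^n\|\le\frac{M}{(\lambda-w)^n}$ for all $n\in\mathbb{N}$ and all $\lambda>w$. In both cases (a) and (b) we have $$\mathsf{C}_\lambda(A)x=\int_0^\infty e^{-t\lambda}T(t)x\,dt\qquad\forall\lambda>w,\ \forall x\in X.$$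
   Context: Algebra. $\mathbb{A}$ is a finite dimensional real alternative algebra with unity $1\ne 0$ (a real vector space with an $\mathbb{R}$-bilinear product, not necessarily associative or commutative, such that $\alpha(\alpha\beta)=(\alpha\alpha)\beta$ and $(\alpha\beta)\beta=\alpha(\beta\beta)$); $\mathbb{R}$ is identified with $\mathbb{R}\cdot 1\subseteq\mathbb{A}$. It is equipped with an anti-involution $\alpha\mapsto\alpha^c$: $\mathbb{R}$-linear, $(\alpha^c)^c=\alpha$, $(\alpha\beta)^c=\beta^c\alpha^c$, $r^c=r$ for $r\in\mathbb{R}$. Put $t(\alpha)=\alpha+\alpha^c$, $n(\alpha)=\alpha\alpha^c$, $\mathrm{Re}(\alpha)=(\alpha+\alpha^c)/2$; quadratic cone $Q_{\mathbb{A}}:=\mathbb{R}\cup\{\alpha\in\mathbb{A}: t(\alpha),n(\alpha)\in\mathbb{R},\ t(\alpha)^2-4n(\alpha)<0\}$; $\mathbb{S}_{\mathbb{A}}:=\{\mathbf{j}\in Q_{\mathbb{A}}:\mathbf{j}^2=-1\}$. It is assumed that $\mathbb{S}_{\mathbb{A}}\neq\emptyset$ and that $\mathbb{A}$ is endowed with a norm $|\cdot|$ (as a real vector space) with $|\alpha|=\sqrt{n(\alpha)}$ for every $\alpha\in Q_{\mathbb{A}}$. Bimodules. An $\mathbb{A}$-bimodule is an abelian group $V$ with a left scalar multiplication $\mathbb{A}\times V\to V$ and a right scalar multiplication $V\times\mathbb{A}\to V$, both additive in each argument, with $1u=u=u1$, and $r(su)=(rs)u$, $(ur)s=u(rs)$,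 $ru=ur$ for $r,s\in\mathbb{R}$; if $\mathbb{A}$ is associative it is also required that $\alpha(\beta u)=(\alpha\beta)u$, $(u\alpha)\beta=u(\alpha\beta)$, $\alpha(u\beta)=(\alpha u)\beta$ for all $\alpha,\beta\in\mathbb{A}$. ${}_{\mathbb{R}}V$ denotes $V$ as a real vector space. A norm on $V$ is a function $\|\cdot\|:V\to[0,\infty)$ with $\|u\|=0\iff u=0$, $\|u+v\|\le\|u\|+\|v\|$, $\|\alpha u\|\le|\alpha|\|u\|$ and $\|u\alpha\|\le|\alpha|\|u\|$ for $\alpha\in\mathbb{A}$, and $\|\alpha u\|=\|u\alpha\|=|\alpha|\|u\|$ for $\alpha\in Q_{\mathbb{A}}$. $V$ with such a norm is a normed $\mathbb{A}$-bimodule, and a Banach $\mathbb{A}$-bimodule if the norm is complete. Operators. A right $\mathbb{A}$-submodule is an abelian subgroup closed under right scalar multiplication. A right linear operator is an additive map $A:D(A)\to X$, $D(A)$ a right $\mathbb{A}$-submodule of $X$, with $A(u\alpha)=A(u)\alpha$ for $u\in D(A),\alpha\in\mathbb{A}$; it is closed if its graph is closed in $X\times X$. $\mathscr{L}^{r}(X)$ is the set of right linear operators with domain $X$ and finite operator norm $\|A\|=\sup_{u\ne0}\|Au\|/\|u\|$. $D(A^2)=\{x\in D(A):Ax\in D(A)\}$. For $\alpha\in Q_{\mathbb{A}}$ and $A$ closed right linear, $\Delta_\alpha(A):=A^2-2\mathrm{Re}(\alpha)A+|\alpha|^2\mathrm{Id}:D(A^2)\to X$. Spherical resolvent set: $\rho_{s}(A):=\{\alpha\in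 Q_{\mathbb{A}}:\Delta_\alpha(A)\text{ is bijective},\ \Delta_\alpha(A)^{-1}\in\mathscr{L}^{r}(X)\}$. For $\alpha\in\rho_{s}(A)$: $\mathsf{Q}_\alpha(A):=\Delta_\alpha(A)^{-1}$ and the spherical resolvent operator is $\mathsf{C}_\alpha(A):=\mathsf{Q}_\alpha(A)\alpha^c-A\,\mathsf{Q}_\alpha(A)$, where $(\mathsf{Q}_\alpha(A)\alpha^c)(x)=\mathsf{Q}_\alpha(A)(\alpha^c x)$. Semigroups. A semigroup in $X$ is a map $T:[0,\infty)\to\mathscr{L}^{r}(X)$ with $T(t+s)=T(t)T(s)$ for all $t,s>0$ and $T(0)=\mathrm{Id}$; it is strongly continuous if $t\mapsto T(t)x$ is continuous from $[0,\infty)$ to $X$ for every $x\in X$. Its generator is the right linear operator $A$ with $D(A)=\{x\in X:\lim_{h\to0^+}\frac1h(T(h)x-x)\text{ exists}\}$ and $Ax=\lim_{h\to0^+}\frac1h(T(h)x-x)$. $e^{tB}=\sum_{n\ge0}(tB)^n/n!$ for $B\in\mathscr{L}^r(X)$. ($A_n$ is considered for integers $n>w$, $n \geq 1$.) *)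

(* Defs.v *)
From Stdlib Require Import Reals Factorial.
From Coquelicot Require Import Coquelicot.
Open Scope R_scope.

(* Finite dimensional real alternative algebra with unity and anti-involution.
   The underlying normed real vector space is a Coquelicot [NormedModule]. *)
Record star_algebra := {
  sa_car :> NormedModule R_AbsRing;
  one : sa_car;
  mul : sa_car -> sa_car -> sa_car;
  conj : sa_car -> sa_car;
  sa_findim : exists (n : nat) (e : nat -> sa_car), forall a : sa_car,
    exists c : nat -> R, a = sum_n (fun i => scal (c i) (e i)) n;
  sa_one_neq0 : one <> zero;
  sa_mul_1l : forall a, mul one a = a;
  sa_mul_1r : forall a, mul a one = a;
  sa_mul_plus_l : forall a b c, mul (plus a b) c = plus (mul a c) (mul b c);
  sa_mul_plus_r : forall a b c, mul a (plus b c) = plus (mul a b) (mul a c);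
  sa_mul_scal_l : forall (r : R) a b, mul (scal r a) b = scal r (mul a b);
  sa_mul_scal_r : forall (r : R) a b, mul a (scal r b) = scal r (mul a b);
  sa_alt_l : forall a b, mul a (mul a b) = mul (mul a a) b;
  sa_alt_r : forall a b, mul (mul a b) b = mul a (mul b b);
  sa_conj_plus : forall a b, conj (plus a b) = plus (conj a) (conj b);
  sa_conj_scal : forall (r : R) a, conj (scal r a) = scal r (conj a);
  sa_conj_conj : forall a, conj (conj a) = a;
  sa_conj_mul : forall a b, conj (mul a b) = mul (conj b) (conj a);
  sa_conj_real : forall r : R, conj (scal r one) = scal r one
}.

Arguments one {s}.
Arguments mul {s} _ _.
Arguments conj {s} _.

(* The identification of R with R 1. *)
Definition of_real {K : star_algebra} (r : R) : K := scal r one.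

Definition tr {K : star_algebra} (a : K) : K := plus a (conj a).
Definition nm {K : star_algebra} (a : K) : K := mul a (conj a).
Definition re {K : star_algebra} (a : K) : K := scal (/ 2) (plus a (conj a)).

Definition quadratic_cone {K : star_algebra} (a : K) : Prop :=
  (exists r : R, a = of_real r) \/
  (exists t n : R, tr a = of_real t /\ nm a = of_real n /\ t ^ 2 - 4 * n < 0).

Definition imag_units {K : star_algebra} (j : K) : Prop :=
  quadratic_cone j /\ mul j j = opp one.

Record normed_star_algebra := {
  nsa_alg :> star_algebra;
  nsa_imag_unit : exists j : nsa_alg, imag_units j;
  nsa_norm_cone : forall (a : nsa_alg) (r : R),
    quadratic_cone a -> nm a = of_real r -> norm a = sqrt r
}.

(* The abelian group, the real vector space structure and the (complete) norm
   come from the [CompleteNormedModule]; [bb_real_l] and [bb_real_r] say that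
   its real scalar multiplication is the restriction of both actions, which
   gives 1u = u = u1, r(su) = (rs)u, (ur)s = u(rs) and ru = ur. *)
Record banach_bimodule (K : normed_star_algebra) := {
  bb_car :> CompleteNormedModule R_AbsRing;
  lact : K -> bb_car -> bb_car;
  ract : bb_car -> K -> bb_car;
  bb_lact_plus_l : forall a b u, lact (plus a b) u = plus (lact a u) (lact b u);
  bb_lact_plus_r : forall a u v, lact a (plus u v) = plus (lact a u) (lact a v);
  bb_ract_plus_l : forall u v a, ract (plus u v) a = plus (ract u a) (ract v a);
  bb_ract_plus_r : forall u a b, ract u (plus a b) = plus (ract u a) (ract u b);
  bb_real_l : forall (r : R) u, lact (of_real r) u = scal r u;
  bb_real_r : forall (r : R) u, ract u (of_real r) = scal r u;
  bb_assoc : (forall a b c : K, mul a (mul b c) = mul (mul a b) c) ->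
    forall (a b : K) u,
      lact a (lact b u) = lact (mul a b) u /\
      ract (ract u a) b = ract u (mul a b) /\
      lact a (ract u b) = ract (lact a u) b;
  bb_norm_l : forall a u, norm (lact a u) <= norm a * norm u;
  bb_norm_r : forall u a, norm (ract u a) <= norm a * norm u;
  bb_norm_cone : forall a u, quadratic_cone a ->
    norm (lact a u) = norm a * norm u /\ norm (ract u a) = norm a * norm u
}.

Arguments lact {K _} _ _.
Arguments ract {K _} _ _.

(* A map defined on a subset of X: the values of [fn] outside [dom] are
   irrelevant. *)
Record pmap {K : normed_star_algebra} (X : banach_bimodule K) := PMap {
  dom : X -> Prop;
  fn :> X -> X
}.

Arguments PMap {K X} _ _.
Arguments dom {K X} _ _.
Arguments fn {K X} _ _.

Section Operators.
Context {K : normed_star_algebra} {X : banach_bimodule K}.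

Definition pmap_eq (A B : pmap X) : Prop :=
  (forall x, dom A x <-> dom B x) /\ (forall x, dom A x -> A x = B x).

Definition right_submodule (D : X -> Prop) : Prop :=
  D zero /\ (forall u v, D u -> D v -> D (plus u v)) /\
  (forall u, D u -> D (opp u)) /\ (forall u (a : K), D u -> D (ract u a)).

Definition right_linear (A : pmap X) : Prop :=
  right_submodule (dom A) /\
  (forall u v, dom A u -> dom A v -> A (plus u v) = plus (A u) (A v)) /\
  (forall u (a : K), dom A u -> A (ract u a) = ract (A u) a).

Definition closed_graph (A : pmap X) : Prop :=
  closed (fun p : X * X => dom A (fst p) /\ snd p = A (fst p)).

Definition densely_defined (A : pmap X) : Prop :=
  forall (x : X) (eps : R), 0 < eps ->
    exists y, dom A y /\ norm (minus y x) < eps.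

(* 0 is added to the set so that the norm is 0 when X is trivial. *)
Definition op_norm (B : X -> X) : Rbar :=
  Lub_Rbar (fun r => r = 0 \/ exists u, u <> zero /\ r = norm (B u) / norm u).

Definition bounded_right_linear (B : X -> X) : Prop :=
  right_linear (PMap (fun _ => True) B) /\ is_finite (op_norm B).

Definition dom_sq (A : pmap X) (x : X) : Prop := dom A x /\ dom A (A x).

Definition Delta (A : pmap X) (a : K) (x : X) : X :=
  plus (minus (A (A x)) (lact (scal 2 (re a)) (A x))) (scal (norm a ^ 2) x).

(* The inverse of Delta_a(A) : D(A^2) -> X, meaningful when it is bijective. *)
Definition Qop (A : pmap X) (a : K) (y : X) : X :=
  iota (fun x : X => dom_sq A x /\ Delta A a x = y).

Definition sph_resolvent_set (A : pmap X) (a : K) : Prop :=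
  quadratic_cone a /\
  (forall y, exists! x, dom_sq A x /\ Delta A a x = y) /\
  bounded_right_linear (Qop A a).

Definition Cop (A : pmap X) (a : K) (x : X) : X :=
  minus (Qop A a (lact (conj a) x)) (A (Qop A a x)).

(* e^B = sum_k B^k / k!, the series converging in operator norm. *)
Definition is_op_exp (B E : X -> X) : Prop :=
  bounded_right_linear E /\
  forall eps : R, 0 < eps -> eventually (fun N =>
    Rbar_lt (op_norm (fun x =>
      minus (sum_n (fun k => scal (/ INR (fact k)) (Nat.iter k B x)) N) (E x)))
      eps).

Definition op_exp (B : X -> X) (x : X) : X :=
  iota (fun y : X => exists E, is_op_exp B E /\ y = E x).

Definition yosida (A : pmap X) (n : nat) (x : X) : X :=
  scal (INR n) (A (Cop A (of_real (INR n)) x)).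

(* Only the values T t with 0 <= t matter. *)
Definition semigroup (T : R -> X -> X) : Prop :=
  (forall t, 0 <= t -> bounded_right_linear (T t)) /\
  (forall t s, 0 < t -> 0 < s -> forall x, T (t + s) x = T t (T s x)) /\
  (forall x, T 0 x = x).

Definition strongly_continuous (T : R -> X -> X) : Prop :=
  forall x, continuous_on (fun t : R => 0 <= t) (fun t : R => T t x).

Definition is_gen_lim (T : R -> X -> X) (x y : X) : Prop :=
  filterlim (fun h : R => scal (/ h) (minus (T h x) x))
    (at_right 0) (locally y).

Definition generator (T : R -> X -> X) : pmap X :=
  PMap (fun x => exists y, is_gen_lim T x y)
       (fun x => iota (is_gen_lim T x)).

(* C_l(A) x is the improper Riemann integral of e^{-tl} T(t) x over [0,oo),
   for all l > w and all x. *)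
Definition laplace_formula (A : pmap X) (T : R -> X -> X) (w : R) : Prop :=
  forall l : R, w < l -> forall x : X,
    is_RInt_gen (fun t : R => scal (exp (- (t * l))) (T t x))
      (at_point 0) (Rbar_locally p_infty) (Cop A (of_real l) x).

End Operators.

(* Main.v *)
Require Import Defs.
From Stdlib Require Import Reals Factorial Lra Lia List Classical ClassicalEpsilon.
From Coquelicot Require Import Coquelicot.
Open Scope R_scope.

(** At a real point l the spherical resolvent is the ordinary one. Since conj l = l
    and Re l = l, one has Delta_l(A) = (l - A)^2, hence Q_l(A) = (l - A)^{-2} and
    C_l(A) = (l - A) Q_l(A) = (l - A)^{-1} ([Cop_right_inverse], [Cop_left_inverse];
    conversely [sph_resolvent_set_of_inverse]). The hypotheses only concern real
    points, so the theorem becomes the Hille-Yosida theorem on the real Banach space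
    underlying X, and the algebra only enters through the maps u |-> u a. These are
    bounded and additive, hence real linear ([ract_is_linear]), and every operator
    constructed below commutes with all bounded operators that commute with the
    data; applied to u |-> u a this gives right linearity.

    Generation. With A_n = n A C_n = n^2 C_n - n, the flow e^{tA_n} equals
    e^{-nt} e^{t n^2 C_n}, and the bounds on all powers of C_n give
    |e^{tA_n}| <= M exp(t n w / (n - w)) ([yosida_flow_norm_le]), whose rate tends
    to w. The A_n commute and converge to A on D(A), so Duhamel's principle
    ([exp_flow_duhamel]) makes the flows converge on the dense set D(A), and by the
    uniform bounds everywhere. The generator of the limit extends A; for l > w both
    l - A and l - (generator) are bijective, so the two are equal
    ([gen_lim_yosida_semigroup_inv]).

    Properties of a generator. Orbits are bounded on [0, 1], so the uniform
    boundedness principle and the semigroup law give |T(t)| <= M e^{wt}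
    ([c0_growth_bound]). For l > w the Laplace transform R_l x, the integral of
    e^{-tl} T(t) x over [0, oo), inverts l - (generator): the partial integrals F
    satisfy T(h) F(t) = e^{lh} (F(t + h) - F(h)), and everything follows by
    differentiating at h = 0 ([gen_lim_laplace], [laplace_left_inverse]). Powers of
    R_l are estimated with the weighted norm sup_t e^{-wt} |T(t) x|, which R_l
    contracts by 1/(l - w) ([laplace_orbit_norm_le]).

    Identities and estimates between vector-valued functions are obtained from a
    mean value inequality ([mean_value_norm]): two functions with the same derivative
    and the same value at 0 agree. This replaces most manipulations of integrals. *)

(** * Linear identities in real modules *)

(** Syntax of the linear expressions that [vec] decides: such an identity holds in every
    real module as soon as the coefficients of each atom agree, which [ring] or
    [field] can check. *)
Inductive vexp : Type :=
  | Vzero | Vatom (n : nat) | Vplus (a b : vexp) | Vopp (a : vexp)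
  | Vminus (a b : vexp) | Vscal (r : R) (a : vexp).

Fixpoint vden {V : ModuleSpace R_Ring} (l : list V) (e : vexp) : V :=
  match e with
  | Vzero => zero
  | Vatom n => nth n l zero
  | Vplus a b => plus (vden l a) (vden l b)
  | Vopp a => opp (vden l a)
  | Vminus a b => minus (vden l a) (vden l b)
  | Vscal r a => scal (r : R_Ring) (vden l a)
  end.

Fixpoint vcoef (e : vexp) (m : nat) : R :=
  match e with
  | Vzero => 0
  | Vatom n => if Nat.eqb n m then 1 else 0
  | Vplus a b => vcoef a m + vcoef b m
  | Vopp a => - vcoef a m
  | Vminus a b => vcoef a m - vcoef b m
  | Vscal r a => r * vcoef a m
  end.

Fixpoint lincomb {V : ModuleSpace R_Ring} (c : nat -> R) (l : list V) : V :=
  match l with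
  | nil => zero
  | a :: l' => plus (scal (c 0%nat : R_Ring) a) (lincomb (fun n => c (S n)) l')
  end.

Fixpoint vagree (k : nat) (e1 e2 : vexp) : Prop :=
  match k with
  | O => True
  | S k' => vcoef e1 k' = vcoef e2 k' /\ vagree k' e1 e2
  end.

Section ModuleIdentities.
Context {V : ModuleSpace R_Ring}.
Implicit Types (l : list V) (c d : nat -> R).

Lemma lincomb_ext c d l :
  (forall n, (n < length l)%nat -> c n = d n) -> lincomb c l = lincomb d l.
Proof.
  revert c d; induction l as [|a l IH]; intros c d H; simpl; [reflexivity|].
  rewrite (H 0%nat) by (simpl; lia).
  rewrite (IH _ (fun n => d (S n))); [reflexivity|].
  intros n Hn; apply H; simpl; lia.
Qed.

Lemma lincomb_0 l : lincomb (fun _ => 0) l = zero.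
Proof.
  induction l as [|a l IH]; simpl; [reflexivity|].
  rewrite IH, plus_zero_r; exact (scal_zero_l a).
Qed.

Lemma lincomb_plus c d l :
  lincomb (fun n => c n + d n) l = plus (lincomb c l) (lincomb d l).
Proof.
  revert c d; induction l as [|a l IH]; intros c d; simpl.
  - now rewrite plus_zero_r.
  - rewrite (IH (fun n => c (S n)) (fun n => d (S n))).
    change (c 0%nat + d 0%nat) with (plus (c 0%nat : R_Ring) (d 0%nat)).
    rewrite scal_distr_r, <- !plus_assoc; f_equal.
    rewrite !plus_assoc; f_equal; apply plus_comm.
Qed.

Lemma lincomb_scal (r : R) c l :
  lincomb (fun n => r * c n) l = scal (r : R_Ring) (lincomb c l).
Proof.
  revert c; induction l as [|a l IH]; intros c; simpl.
  - now rewrite scal_zero_r.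
  - rewrite (IH (fun n => c (S n))), scal_distr_l, scal_assoc; reflexivity.
Qed.

Lemma lincomb_opp c l : lincomb (fun n => - c n) l = opp (lincomb c l).
Proof.
  rewrite <- scal_opp_one, (lincomb_ext _ (fun n => - 1 * c n)).
  - apply lincomb_scal.
  - intros; ring.
Qed.

Lemma lincomb_atom n l :
  lincomb (fun m => if Nat.eqb n m then 1 else 0) l = nth n l zero.
Proof.
  revert n; induction l as [|a l IH]; intros n; simpl.
  - now destruct n.
  - destruct n as [|n]; simpl.
    + rewrite lincomb_0, plus_zero_r; exact (scal_one a).
    + rewrite IH; transitivity (plus zero (nth n l zero)); [|apply plus_zero_l].
      f_equal; exact (scal_zero_l a).
Qed.

Lemma vden_lincomb l e : vden l e = lincomb (vcoef e) l.
Proof.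
  induction e; simpl.
  - now rewrite lincomb_0.
  - now rewrite lincomb_atom.
  - now rewrite lincomb_plus, IHe1, IHe2.
  - now rewrite lincomb_opp, IHe.
  - unfold minus; rewrite IHe1, IHe2, <- lincomb_opp, <- lincomb_plus; reflexivity.
  - now rewrite lincomb_scal, IHe.
Qed.

Lemma vden_agree l e1 e2 : vagree (length l) e1 e2 -> vden l e1 = vden l e2.
Proof.
  intros H; rewrite !vden_lincomb; apply lincomb_ext.
  generalize dependent (length l); intros k; induction k as [|k IH]; intros H n Hn.
  - lia.
  - destruct H as [H H']; destruct (Nat.eq_dec n k) as [->|]; [exact H|].
    apply IH; [exact H'|lia].
Qed.

End ModuleIdentities.

Ltac vec_index a l :=
  match l with
  | a :: _ => constr:(O)
  | _ :: ?l' => let n := vec_index a l' in constr:(S n)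
  end.

Ltac vec_atoms e l :=
  match e with
  | @plus _ ?a ?b => let l := vec_atoms a l in vec_atoms b l
  | @minus _ ?a ?b => let l := vec_atoms a l in vec_atoms b l
  | @opp _ ?a => vec_atoms a l
  | @scal _ _ _ ?a => vec_atoms a l
  | @zero _ => l
  | _ => match l with
         | context [e :: _] => l
         | _ => constr:(e :: l)
         end
  end.

Ltac vec_reify e l :=
  match e with
  | @plus _ ?a ?b =>
      let a := vec_reify a l in let b := vec_reify b l in constr:(Vplus a b)
  | @minus _ ?a ?b =>
      let a := vec_reify a l in let b := vec_reify b l in constr:(Vminus a b)
  | @opp _ ?a => let a := vec_reify a l in constr:(Vopp a)
  | @scal _ _ ?r ?a => let a := vec_reify a l in constr:(Vscal r a)
  | @zero _ => constr:(Vzero)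
  | _ => let n := vec_index e l in constr:(Vatom n)
  end.

Ltac vec_with tac :=
  match goal with
  | |- @eq ?T ?x ?y =>
      let l := vec_atoms x (@nil T) in
      let l := vec_atoms y l in
      let e1 := vec_reify x l in
      let e2 := vec_reify y l in
      refine (vden_agree l e1 e2 _);
      cbv [vagree vcoef Nat.eqb length]; repeat split; tac
  end.

Ltac vec := vec_with ltac:(ring).

Ltac vec_field := vec_with ltac:(field; auto).

(** * Norms and limits *)

Section NormedSpace.
Context {V : CompleteNormedModule R_AbsRing}.
Implicit Types (x y z : V).

Lemma norm_scal_R (r : R) x : norm (scal r x) = Rabs r * norm x.
Proof.
  apply Rle_antisym; [exact (norm_scal r x)|].
  destruct (Req_dec r 0) as [->|Hr].
  - rewrite Rabs_R0, Rmult_0_l; apply norm_ge_0.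
  - assert (H : norm x <= Rabs (/ r) * norm (scal r x)).
    { replace x with (scal (/ r) (scal r x)) at 1 by vec_field.
      exact (norm_scal (/ r) (scal r x)). }
    apply Rmult_le_compat_l with (r := Rabs r) in H; [|apply Rabs_pos].
    rewrite <- Rmult_assoc, <- Rabs_mult, Rinv_r, Rabs_R1, Rmult_1_l in H by exact Hr.
    exact H.
Qed.

Lemma norm_plus_le x y : norm (plus x y) <= norm x + norm y.
Proof. exact (norm_triangle x y). Qed.

Lemma norm_zero_eq : norm (zero : V) = 0.
Proof. exact (@norm_zero R_AbsRing V). Qed.

Lemma norm_minus_le x y : norm (minus x y) <= norm x + norm y.
Proof. unfold minus; rewrite <- (norm_opp y); exact (norm_triangle x (opp y)). Qed.

Lemma norm_le_minus x y : norm x <= norm (minus x y) + norm y.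
Proof.
  replace x with (plus (minus x y) y) at 1 by vec; exact (norm_triangle (minus x y) y).
Qed.

Lemma norm_minus_sym x y : norm (minus x y) = norm (minus y x).
Proof. rewrite <- norm_opp; f_equal; vec. Qed.

Lemma norm_between x y z : norm (minus x z) <= norm (minus x y) + norm (minus y z).
Proof.
  replace (minus x z) with (plus (minus x y) (minus y z)) by vec.
  exact (norm_triangle (minus x y) (minus y z)).
Qed.

Lemma eq_of_minus_zero x y : minus x y = zero -> x = y.
Proof.
  intros H; replace x with (plus (minus x y) y) by vec.
  rewrite H; apply plus_zero_l.
Qed.

Lemma eq_of_norm_small x y : (forall eps, 0 < eps -> norm (minus x y) <= eps) -> x = y.
Proof.
  intros H; apply eq_of_minus_zero, (@norm_eq_zero R_AbsRing V), Rle_antisym; [|apply norm_ge_0].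
  apply le_epsilon; intros eps He; rewrite Rplus_0_l; auto.
Qed.

Lemma lim_norm {T : Type} (F : (T -> Prop) -> Prop) {FF : Filter F} (f : T -> V) (l : V) :
  filterlim f F (locally l) <->
  forall eps, 0 < eps -> F (fun t => norm (minus (f t) l) < eps).
Proof.
  split.
  - intros H eps He.
    exact (proj1 (filterlim_locally_ball_norm f l) H (mkposreal eps He)).
  - intros H; refine (proj2 (filterlim_locally_ball_norm f l) _); intros eps.
    exact (H eps (cond_pos eps)).
Qed.

(** Closed balls are closed: the form in which every estimate is passed to a limit. *)
Lemma lim_norm_minus_le {T : Type} (F : (T -> Prop) -> Prop) {FF : ProperFilter F}
    (f : T -> V) (l z : V) (c : R) :
  filterlim f F (locally l) -> F (fun t => norm (minus (f t) z) <= c) ->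
  norm (minus l z) <= c.
Proof.
  intros Hl Hc; apply le_epsilon; intros eps He.
  destruct (filter_ex _ (filter_and _ _ Hc (proj1 (lim_norm F f l) Hl eps He)))
    as [t [H1 H2]].
  apply Rle_trans with (1 := norm_between l (f t) z).
  rewrite (norm_minus_sym l); lra.
Qed.

Lemma lim_norm_le {T : Type} (F : (T -> Prop) -> Prop) {FF : ProperFilter F}
    (f : T -> V) (l : V) (c : R) :
  filterlim f F (locally l) -> F (fun t => norm (f t) <= c) -> norm l <= c.
Proof.
  intros Hl Hc; replace l with (minus l zero) by vec.
  apply (lim_norm_minus_le F f); [exact Hl|].
  apply filter_imp with (2 := Hc); intros t Ht.
  now replace (minus (f t) zero) with (f t) by vec.
Qed.

Lemma lim_unique {T : Type} (F : (T -> Prop) -> Prop) {FF : ProperFilter F}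
    (f : T -> V) (l l' : V) :
  filterlim f F (locally l) -> filterlim f F (locally l') -> l = l'.
Proof. intros H H'; exact (filterlim_locally_unique f l l' H H'). Qed.

Lemma lim_plus {T : Type} (F : (T -> Prop) -> Prop) {FF : Filter F} (f g : T -> V) l m :
  filterlim f F (locally l) -> filterlim g F (locally m) ->
  filterlim (fun t => plus (f t) (g t)) F (locally (plus l m)).
Proof. intros H H'; exact (filterlim_comp_2 f g plus H H' (filterlim_plus l m)). Qed.

Lemma lim_scal {T : Type} (F : (T -> Prop) -> Prop) {FF : Filter F} (r : R) (f : T -> V) l :
  filterlim f F (locally l) ->
  filterlim (fun t => scal r (f t)) F (locally (scal r l)).
Proof. intros H; exact (filterlim_comp _ _ _ _ _ _ _ _ H (filterlim_scal_r r l)). Qed.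

Lemma lim_minus {T : Type} (F : (T -> Prop) -> Prop) {FF : Filter F} (f g : T -> V) l m :
  filterlim f F (locally l) -> filterlim g F (locally m) ->
  filterlim (fun t => minus (f t) (g t)) F (locally (minus l m)).
Proof.
  intros H H'; apply lim_plus; [exact _|exact H|].
  exact (filterlim_comp _ _ _ _ _ _ _ _ H' (filterlim_opp m)).
Qed.

Lemma lim_linear {T : Type} (F : (T -> Prop) -> Prop) (L : V -> V) (f : T -> V) l :
  is_linear L -> filterlim f F (locally l) ->
  filterlim (fun t => L (f t)) F (locally (L l)).
Proof. intros HL H; exact (filterlim_comp _ _ _ _ _ _ _ _ H (linear_cont L l HL)). Qed.

Lemma cauchy_lim {T : Type} (F : (T -> Prop) -> Prop) {FF : ProperFilter F} (f : T -> V) :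
  (forall eps, 0 < eps ->
     exists P, F P /\ forall s t, P s -> P t -> norm (minus (f s) (f t)) < eps) ->
  exists l, filterlim f F (locally l).
Proof.
  intros H; refine (proj1 (filterlim_locally_cauchy f) _); intros eps.
  destruct (H eps (cond_pos eps)) as [P [HP HP']].
  exists P; split; [exact HP|]; intros s t Hs Ht.
  apply (@norm_compat1 R_AbsRing V); auto.
Qed.

Lemma is_derive_norm (f : R -> V) (t : R) (l : V) :
  is_derive f t l <->
  forall eps, 0 < eps -> exists d, 0 < d /\ forall h, Rabs h < d ->
    norm (minus (minus (f (t + h)) (f t)) (scal h l)) <= eps * Rabs h.
Proof.
  split.
  - intros [_ H] eps He.
    specialize (H t (fun P HP => HP) (mkposreal eps He)).
    destruct H as [d Hd]; exists d; split; [apply cond_pos|]; intros h Hh.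
    assert (E : t + h - t = h) by ring.
    assert (Hb : ball t d (t + h)).
    { change (Rabs (t + h - t) < d); now rewrite E. }
    specialize (Hd (t + h) Hb).
    change (norm (minus (minus (f (t + h)) (f t)) (scal (t + h - t) l))
            <= eps * Rabs (t + h - t)) in Hd.
    now rewrite E in Hd.
  - intros H; split; [exact (is_linear_scal_l l)|].
    intros x Hx eps.
    assert (Ex : t = x) by (apply (is_filter_lim_locally_unique t x Hx)).
    subst x; destruct (H eps (cond_pos eps)) as [d [Hd Hd']].
    exists (mkposreal d Hd); intros s Hs.
    specialize (Hd' (s - t) Hs).
    assert (E : forall a b : R, a + (b - a) = b) by (intros; ring).
    now rewrite E in Hd'.
Qed.

End NormedSpace.

Ltac simpl_norm_scal :=
  repeat match goal with
  | |- context [@norm ?K ?W (@scal ?r ?m ?a ?x)] =>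
      replace (@norm K W (@scal r m a x)) with (Rabs a * @norm K W x)
        by (symmetry; exact (norm_scal_R a x))
  end.

(** [replace] under a norm; the pattern is found by its head symbol because equal
    vectors may be built from different, convertible projections of the structure. *)
Ltac norm_replace e :=
  match goal with
  | |- context [@norm ?K ?W ?x] =>
      replace (@norm K W x) with (@norm K W e); [|apply (f_equal (@norm K W)); symmetry]
  end.

Ltac simpl_norm_zero :=
  match goal with
  | |- context [@norm ?K ?W (@zero ?G)] =>
      replace (@norm K W (@zero G)) with 0 by (symmetry; exact norm_zero_eq)
  end.

(** The group, module and norm operations of a complete normed module can be reached
    through several convertible projections, and [lra] would treat norms written with
    different ones as different unknowns. [vec_canon_norms] rewrites every norm with
    one fixed choice of projections; [vnorm] marks those already treated. *)
Definition vnorm {V : CompleteNormedModule R_AbsRing} (x : V) : R := norm x.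

Ltac vec_canon V e :=
  match e with
  | @plus _ ?a ?b =>
      let a := vec_canon V a in let b := vec_canon V b in
      constr:(@plus (CompleteNormedModule.AbelianMonoid R_AbsRing V) a b)
  | @minus _ ?a ?b =>
      let a := vec_canon V a in let b := vec_canon V b in
      constr:(@minus (CompleteNormedModule.AbelianGroup R_AbsRing V) a b)
  | @opp _ ?a =>
      let a := vec_canon V a in
      constr:(@opp (CompleteNormedModule.AbelianGroup R_AbsRing V) a)
  | @scal _ _ ?r ?a =>
      let a := vec_canon V a in
      constr:(@scal R_Ring (CompleteNormedModule.ModuleSpace R_AbsRing V) r a)
  | @zero _ => constr:(@zero (CompleteNormedModule.AbelianMonoid R_AbsRing V))
  | ?f ?x =>
      let f := vec_canon V f in let x := vec_canon V x in constr:(f x)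
  | _ => e
  end.

Ltac vec_canon_norms :=
  repeat match goal with
  | |- context [@norm ?K ?W ?e] =>
      match W with CompleteNormedModule.NormedModule _ ?V =>
        let e' := vec_canon V e in change (@norm K W e) with (@vnorm V e') end
  | H : ?T |- _ =>
      match T with _ <= _ => idtac | _ < _ => idtac | _ = _ => idtac | _ >= _ => idtac
                 | _ > _ => idtac end;
      match T with context [@norm ?K ?W ?e] =>
      match W with CompleteNormedModule.NormedModule _ ?V =>
        let e' := vec_canon V e in change (@norm K W e) with (@vnorm V e') in H end end
  end.

Lemma vnorm_zero {V : CompleteNormedModule R_AbsRing} : vnorm (zero : V) = 0.
Proof. exact norm_zero_eq. Qed.

Ltac vlra := vec_canon_norms; rewrite ?(@vnorm_zero _) in *; lra.

(** * Differentiation of vector-valued functions *)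

Section Differentiation.
Context {V : CompleteNormedModule R_AbsRing}.
Implicit Types (x y z : V).

(** The supremum of the set of points up to which the estimate holds with an extra
    slope eps is b: the set contains its supremum by the left increments there, and
    could be enlarged by the right increments if the supremum were less than b. *)
Lemma mean_value_norm (f : R -> V) (g : R -> R) (a b : R) :
  a <= b ->
  (forall t, a <= t <= b ->
     exists l m, is_derive f t l /\ is_derive g t m /\ norm l <= m) ->
  norm (minus (f b) (f a)) <= g b - g a.
Proof.
  intros Hab Hd; apply le_epsilon; intros eta Heta.
  set (eps := eta / (b - a + 1)).
  assert (Heps : 0 < eps) by (apply Rdiv_lt_0_compat; lra).
  assert (Hle : eps * (b - a) <= eta).
  { unfold eps; apply Rle_trans with (eta / (b - a + 1) * (b - a + 1)).
    - apply Rmult_le_compat_l; unfold eps in Heps; vlra.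
    - right; field; vlra. }
  apply Rle_trans with (g b - g a + eps * (b - a)); [|vlra].
  (* An increment may start or end at t, so that the supremum below is reached from the
     left and can be passed to the right. *)
  assert (Hloc : forall t, a <= t <= b -> exists d, 0 < d /\ forall h, 0 <= h < d ->
     norm (minus (f (t + h)) (f t)) <= g (t + h) - g t + eps * h /\
     norm (minus (f t) (f (t - h))) <= g t - g (t - h) + eps * h).
  { intros t Ht; destruct (Hd t Ht) as [l [m [Hf [Hg Hlm]]]].
    destruct (proj1 (is_derive_norm f t l) Hf (eps / 2) ltac:(lra)) as [d1 [Hd1 H1]].
    destruct (proj1 (is_derive_norm (V := R_CompleteNormedModule) g t m) Hg (eps / 2) ltac:(lra))
      as [d2 [Hd2 H2]].
    assert (Hone : forall h, Rabs h < Rmin d1 d2 ->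
      norm (minus (f (t + h)) (f t)) <= Rabs h * m + eps / 2 * Rabs h /\
      Rabs (g (t + h) - g t - h * m) <= eps / 2 * Rabs h).
    { intros h Hh.
      specialize (H1 h (Rlt_le_trans _ _ _ Hh (Rmin_l _ _))).
      specialize (H2 h (Rlt_le_trans _ _ _ Hh (Rmin_r _ _))).
      split; [|exact H2].
      replace (minus (f (t + h)) (f t))
        with (plus (minus (minus (f (t + h)) (f t)) (scal h l)) (scal h l)) by vec.
      apply Rle_trans with (1 := norm_plus_le _ _).
      assert (norm (scal h l) <= Rabs h * m).
      { simpl_norm_scal; apply Rmult_le_compat_l; [apply Rabs_pos|exact Hlm]. }
      vlra. }
    exists (Rmin d1 d2); split; [now apply Rmin_glb_lt|]; intros h [Hh0 Hh].
    assert (Ah : Rabs h = h) by now apply Rabs_pos_eq.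
    assert (Ah' : Rabs (- h) = h) by now rewrite Rabs_Ropp.
    destruct (Hone h) as [A1 A2]; [vlra|].
    destruct (Hone (- h)) as [B1 B2]; [vlra|].
    rewrite Ah in A1, A2; rewrite Ah' in B1, B2.
    apply Rabs_le_between in A2; apply Rabs_le_between in B2.
    change (t + - h) with (t - h) in B1, B2.
    rewrite norm_minus_sym in B1.
    split; vlra. }
  set (E := fun s => a <= s <= b /\
     norm (minus (f s) (f a)) <= g s - g a + eps * (s - a)).
  assert (Ea : E a).
  { split; [vlra|]; replace (minus (f a) (f a)) with (zero : V) by vec.
    rewrite norm_zero_eq; vlra. }
  destruct (completeness E) as [m [Hub Hlub]].
  { exists b; intros s [Hs _]; vlra. }
  { now exists a. }
  assert (Ham : a <= m) by now apply Hub.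
  assert (Hmb : m <= b) by (apply Hlub; intros s [Hs _]; lra).
  destruct (Hloc m (Logic.conj Ham Hmb)) as [d [Hd0 Hdm]].
  assert (Em : E m).
  { destruct (classic (exists s, E s /\ m - d < s)) as [[s [Es Hs]]|Hno].
    - assert (Hsm : s <= m) by now apply Hub.
      destruct (Hdm (m - s)) as [_ H2]; [vlra|].
      replace (m - (m - s)) with s in H2 by ring.
      split; [vlra|].
      apply Rle_trans with (1 := norm_between _ (f s) _).
      destruct Es as [_ Es]; vlra.
    - exfalso; apply (Rlt_irrefl m), Rle_lt_trans with (m - d); [|vlra].
      apply Hlub; intros s Es; apply Rnot_lt_le; intros Hs; apply Hno.
      exists s; split; assumption. }
  destruct (Rle_lt_or_eq_dec m b Hmb) as [Hlt| ->]; [|exact (proj2 Em)].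
  exfalso; set (h := Rmin (b - m) (d / 2)).
  assert (Hh0 : 0 < h) by (apply Rmin_glb_lt; lra).
  assert (Hh1 : h <= b - m) by apply Rmin_l.
  assert (Hh2 : h <= d / 2) by apply Rmin_r.
  destruct (Hdm h) as [H1 _]; [vlra|].
  assert (Emh : E (m + h)).
  { split; [vlra|].
    apply Rle_trans with (1 := norm_between _ (f m) _).
    destruct Em as [_ Em]; vlra. }
  apply Hub in Emh; vlra.
Qed.

Lemma mean_value_norm_const (f : R -> V) (a b c : R) :
  a <= b ->
  (forall t, a <= t <= b -> exists l, is_derive f t l /\ norm l <= c) ->
  norm (minus (f b) (f a)) <= c * (b - a).
Proof.
  intros Hab H; replace (c * (b - a)) with (c * b - c * a) by ring.
  apply (mean_value_norm f (fun t => c * t)); [exact Hab|].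
  intros t Ht; destruct (H t Ht) as [l [Hl Hc]].
  exists l, c; split; [exact Hl|]; split; [auto_derive; [trivial|ring]|exact Hc].
Qed.

Lemma mean_value_norm_sym (f : R -> V) (a b c : R) :
  (forall t, Rmin a b <= t <= Rmax a b -> exists l, is_derive f t l /\ norm l <= c) ->
  norm (minus (f b) (f a)) <= c * Rabs (b - a).
Proof.
  intros H; destruct (Rle_lt_dec a b) as [Hab|Hab].
  - rewrite Rabs_pos_eq by lra; apply mean_value_norm_const; [exact Hab|].
    intros t Ht; apply H; rewrite Rmin_left, Rmax_right; lra.
  - rewrite norm_minus_sym, Rabs_left by lra.
    replace (c * - (b - a)) with (c * (a - b)) by ring.
    apply mean_value_norm_const; [lra|].
    intros t Ht; apply H; rewrite Rmin_right, Rmax_left; lra.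
Qed.

(** The tool for identities between functions of time: compare derivatives. *)
Lemma eq_of_derive_eq (f g : R -> V) (t : R) : 0 <= t ->
  (forall s, 0 <= s <= t -> exists l, is_derive f s l /\ is_derive g s l) ->
  f 0 = g 0 -> f t = g t.
Proof.
  intros Ht Hd H0; apply eq_of_norm_small; intros eps He.
  replace (minus (f t) (g t)) with (minus (minus (f t) (g t)) (minus (f 0) (g 0)))
    by (rewrite H0; vec).
  apply Rle_trans with (0 * (t - 0)); [|lra].
  apply (mean_value_norm_const (fun s => minus (f s) (g s))); [exact Ht|].
  intros s Hs; destruct (Hd s Hs) as [l [Hf Hg]].
  exists (minus l l); split; [exact (is_derive_minus (V := V) _ _ _ _ _ Hf Hg)|].
  replace (minus l l) with (zero : V) by vec; simpl_norm_zero; lra.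
Qed.

Lemma is_derive_eq (f : R -> V) (t : R) (l l' : V) :
  is_derive f t l -> l = l' -> is_derive f t l'.
Proof. now intros H <-. Qed.

Lemma is_derive_scal_id (s : R) y : is_derive (fun u : R => scal u y) s y.
Proof.
  apply is_derive_eq with (scal 1 y); [|vec].
  exact (is_derive_scal_l (V := V) (fun u : R => u) s 1 y (is_derive_id s)).
Qed.

Lemma is_derive_small_increment (f : R -> V) (t : R) (l : V) (eps : R) :
  is_derive f t l -> 0 < eps ->
  exists d, 0 < d /\ forall h, Rabs h < d -> norm (minus (f (t + h)) (f t)) <= eps.
Proof.
  intros Hf He; destruct (proj1 (is_derive_norm f t l) Hf 1 Rlt_0_1) as [d [Hd H]].
  assert (Hl : 0 < norm l + 1) by (pose proof (norm_ge_0 l); lra).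
  exists (Rmin d (eps / (norm l + 1))); split.
  { apply Rmin_glb_lt; [exact Hd|now apply Rdiv_lt_0_compat]. }
  intros h Hh; specialize (H h (Rlt_le_trans _ _ _ Hh (Rmin_l _ _))).
  assert (Hh' := Rlt_le_trans _ _ _ Hh (Rmin_r _ _)).
  apply Rmult_lt_compat_r with (r := norm l + 1) in Hh'; [|exact Hl].
  replace (eps / (norm l + 1) * (norm l + 1)) with eps in Hh' by (field; lra).
  pose proof (norm_le_minus (minus (f (t + h)) (f t)) (scal h l)) as H1.
  assert (N : norm (scal h l) = Rabs h * norm l) by exact (norm_scal_R h l).
  vlra.
Qed.

(** Product rule for an operator-valued function that is only strongly differentiable:
    the uniform bound c near s replaces continuity of S in the operator norm. *)
Lemma is_derive_apply (S : R -> V -> V) (D : V -> V) (v : R -> V) (s c : R) (l : V) :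
  (forall u : R, is_linear (S u)) ->
  locally s (fun u : R => forall y, norm (S u y) <= c * norm y) ->
  (forall y, is_derive (fun u => S u y) s (D y)) ->
  is_derive v s l ->
  is_derive (fun u => S u (v u)) s (plus (D (v s)) (S s l)).
Proof.
  intros HL [d0 Hc] HS Hv; apply is_derive_norm; intros eps He.
  set (c' := Rabs c + 1).
  assert (Hc' : 0 < c') by (unfold c'; pose proof (Rabs_pos c); lra).
  destruct (proj1 (is_derive_norm v s l) Hv (eps / 3 / c')) as [d1 [Hd1 H1]].
  { apply Rdiv_lt_0_compat; lra. }
  destruct (proj1 (is_derive_norm _ s _) (HS (v s)) (eps / 3) ltac:(lra)) as [d2 [Hd2 H2]].
  destruct (is_derive_small_increment _ s _ (eps / 3) (HS l) ltac:(lra)) as [d3 [Hd3 H3]].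
  exists (Rmin (Rmin d0 d1) (Rmin d2 d3)); split.
  { repeat apply Rmin_glb_lt; try assumption; apply cond_pos. }
  intros h Hh.
  assert (Hh01 := Rlt_le_trans _ _ _ Hh (Rmin_l _ _)).
  assert (Hh23 := Rlt_le_trans _ _ _ Hh (Rmin_r _ _)).
  specialize (H1 h (Rlt_le_trans _ _ _ Hh01 (Rmin_r _ _))).
  specialize (H2 h (Rlt_le_trans _ _ _ Hh23 (Rmin_l _ _))).
  specialize (H3 h (Rlt_le_trans _ _ _ Hh23 (Rmin_r _ _))).
  assert (Hb : ball s d0 (s + h)).
  { change (Rabs (s + h - s) < d0); replace (s + h - s) with h by ring.
    exact (Rlt_le_trans _ _ _ Hh01 (Rmin_l _ _)). }
  specialize (Hc (s + h) Hb).
  replace (minus (minus (S (s + h) (v (s + h))) (S s (v s))) (scal h (plus (D (v s)) (S s l))))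
    with (plus (S (s + h) (minus (minus (v (s + h)) (v s)) (scal h l)))
            (plus (minus (minus (S (s + h) (v s)) (S s (v s))) (scal h (D (v s))))
               (scal h (minus (S (s + h) l) (S s l))))).
  2:{ rewrite !(linear_minus _ _ _ (HL (s + h))), (linear_scal _ (HL (s + h))); vec. }
  set (e := minus (minus (v (s + h)) (v s)) (scal h l)) in *.
  pose proof (Hc e) as Hce.
  assert (Hce' : norm (S (s + h) e) <= eps / 3 * Rabs h).
  { apply Rle_trans with (1 := Hce); apply Rle_trans with (c' * norm e).
    - apply Rmult_le_compat_r; [apply norm_ge_0|].
      unfold c'; pose proof (Rle_abs c); lra.
    - apply Rmult_le_compat_l with (r := c') in H1; [|lra].
      replace (c' * (eps / 3 / c' * Rabs h)) with (eps / 3 * Rabs h) in H1 by (field; lra).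
      vlra. }
  apply Rle_trans with (1 := norm_plus_le _ _).
  pose proof (norm_plus_le (minus (minus (S (s + h) (v s)) (S s (v s))) (scal h (D (v s))))
     (scal h (minus (S (s + h) l) (S s l)))) as Ht.
  assert (N : norm (scal h (minus (S (s + h) l) (S s l))) =
     Rabs h * norm (minus (S (s + h) l) (S s l))) by exact (norm_scal_R h _).
  apply Rmult_le_compat_l with (r := Rabs h) in H3; [|apply Rabs_pos].
  vlra.
Qed.

Lemma is_derive_linear (L : V -> V) (f : R -> V) (t : R) (l : V) :
  is_linear L -> is_derive f t l -> is_derive (fun s => L (f s)) t (L l).
Proof.
  intros HL Hf; destruct (linear_norm _ HL) as [c [_ Hc]].
  apply is_derive_eq with (plus zero (L l)); [|vec].
  apply (is_derive_apply (fun _ => L) (fun _ => zero) f t c); [easy| | |exact Hf].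
  - now exists (mkposreal 1 Rlt_0_1).
  - intros y; exact (is_derive_const (L y) t).
Qed.

Lemma exp_mono r s : r <= s -> exp r <= exp s.
Proof.
  intros [H| ->]; [now apply Rlt_le, exp_increasing|apply Rle_refl].
Qed.

Lemma is_derive_exp_scal (a : R) (f : R -> V) (t : R) (l : V) :
  is_derive f t l ->
  is_derive (fun s => scal (exp (a * s)) (f s)) t
    (plus (scal (a * exp (a * t)) (f t)) (scal (exp (a * t)) l)).
Proof.
  intros Hf.
  apply (is_derive_apply (fun s y => scal (exp (a * s)) y) (fun y => scal (a * exp (a * t)) y)
           f t (exp (Rabs a * (Rabs t + 1)))); [| | |exact Hf].
  - intros u; exact (is_linear_scal_r (exp (a * u)) Rmult_comm).
  - exists (mkposreal 1 Rlt_0_1); intros u Hu y; simpl_norm_scal.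
    apply Rmult_le_compat_r; [apply norm_ge_0|].
    rewrite (Rabs_pos_eq (exp _)) by apply Rlt_le, exp_pos; apply exp_mono.
    apply Rle_trans with (1 := Rle_abs _); rewrite Rabs_mult.
    apply Rmult_le_compat_l; [apply Rabs_pos|].
    change (Rabs (u - t) < 1) in Hu; unfold Rabs in *; repeat destruct Rcase_abs; lra.
  - intros y; refine (is_derive_scal_l (V := V) (fun s => exp (a * s)) t _ y _).
    auto_derive; [trivial|ring].
Qed.

End Differentiation.

(** * The uniform boundedness principle *)

Section UniformBoundedness.
Context {V : CompleteNormedModule R_AbsRing}.
Implicit Types (x y z : V).

(** Gliding hump. If the bounds were not uniform, one could shrink a ball again and
    again so that some B i has norm at least n on all of the (n+1)-st ball; a common point of
    the balls would have an unbounded orbit. *)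
Lemma uniform_boundedness {I : Type} (B : I -> V -> V) :
  (forall i, is_linear (B i)) ->
  (forall x, exists c, forall i, norm (B i x) <= c) ->
  exists c, forall i x, norm (B i x) <= c * norm x.
Proof.
  intros HL Hpt; apply NNPP; intros Hno.
  assert (Hbig : forall c, exists i x, c * norm x < norm (B i x)).
  { intros c; apply NNPP; intros H; apply Hno; exists c; intros i x.
    apply Rnot_lt_le; intros H'; apply H; now exists i, x. }
  (* One of y + x and y - x is moved at least as far as x. *)
  assert (Hmove : forall y r c, 0 < r -> 0 <= c ->
            exists i z, norm (minus z y) <= r /\ c < norm (B i z)).
  { intros y r c Hr Hc; destruct (Hbig (c / r)) as [i [x Hx]].
    assert (Hx0 : 0 < norm x).
    { apply (@norm_gt_0 R_AbsRing V); intros ->.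
      rewrite (linear_zero _ (HL i)) in Hx; vlra. }
    set (x' := scal (r / norm x) x).
    assert (Hrx : 0 < r / norm x) by now apply Rdiv_lt_0_compat.
    assert (Nx' : norm x' = r).
    { unfold x'; simpl_norm_scal; rewrite Rabs_pos_eq by lra; field; vlra. }
    assert (Bx' : c < norm (B i x')).
    { unfold x'; rewrite (linear_scal _ (HL i)); simpl_norm_scal; rewrite Rabs_pos_eq by vlra.
      apply Rmult_lt_compat_l with (r := r / norm x) in Hx; [|exact Hrx].
      replace (r / norm x * (c / r * norm x)) with c in Hx by (field; lra); exact Hx. }
    assert (Hsum : 2 * norm (B i x') <= norm (B i (plus y x')) + norm (B i (minus y x'))).
    { rewrite (linear_plus _ (HL i)), (linear_minus _ _ _ (HL i)).
      replace (2 * norm (B i x')) with (norm (scal 2 (B i x')))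
        by (simpl_norm_scal; rewrite Rabs_pos_eq; lra).
      replace (scal 2 (B i x'))
        with (minus (plus (B i y) (B i x')) (minus (B i y) (B i x'))) by vec.
      apply norm_minus_le. }
    destruct (Rle_lt_dec (norm (B i (plus y x'))) c) as [H|H].
    - exists i, (minus y x'); split; [|vlra].
      replace (minus (minus y x') y) with (opp x') by vec.
      rewrite (@norm_opp R_AbsRing V); vlra.
    - exists i, (plus y x'); split; [|exact H].
      replace (minus (plus y x') y) with x' by vec; vlra. }
  assert (Hstep : forall (n : nat) (p : V * R), 0 < snd p ->
     exists q : V * R, 0 < snd q <= snd p / 2 /\
       norm (minus (fst q) (fst p)) <= snd p / 2 /\
       exists i, forall z, norm (minus z (fst q)) <= snd q -> INR n <= norm (B i z)).
  { intros n [y r] Hr; simpl in *.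
    destruct (Hmove y (r / 2) (INR n + 1)) as [i [z [Hz Hiz]]];
      [vlra|pose proof (pos_INR n); lra|].
    destruct (linear_norm _ (HL i)) as [M [HM HBM]].
    exists (z, Rmin (r / 2) (/ M)); simpl; repeat split.
    - apply Rmin_glb_lt; [vlra|now apply Rinv_0_lt_compat].
    - apply Rmin_l.
    - exact Hz.
    - exists i; intros z' Hz'.
      pose proof (Rle_trans _ _ _ Hz' (Rmin_r _ _)) as Hz''.
      pose proof (norm_le_minus (B i z) (B i z')) as Hb.
      rewrite norm_minus_sym, <- (linear_minus _ _ _ (HL i)) in Hb.
      pose proof (HBM (minus z' z)) as H1.
      apply Rmult_le_compat_l with (r := M) in Hz''; [|vlra].
      rewrite Rinv_r in Hz'' by lra; vlra. }
  set (next := fun (n : nat) (p : {p : V * R | 0 < snd p}) =>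
     let q := constructive_indefinite_description _ (Hstep n (proj1_sig p) (proj2_sig p)) in
     exist (fun p : V * R => 0 < snd p) (proj1_sig q) (proj1 (proj1 (proj2_sig q)))).
  set (s := fix s (n : nat) : {p : V * R | 0 < snd p} :=
     match n with O => exist _ (zero, 1) Rlt_0_1 | S n => next n (s n) end).
  set (y := fun n => fst (proj1_sig (s n))); set (r := fun n => snd (proj1_sig (s n))).
  assert (Hs : forall n, 0 < r (S n) <= r n / 2 /\ norm (minus (y (S n)) (y n)) <= r n / 2 /\
     exists i, forall z, norm (minus z (y (S n))) <= r (S n) -> INR n <= norm (B i z)).
  { intros n; unfold y, r; simpl; unfold next; simpl.
    destruct (constructive_indefinite_description _ _) as [q Hq]; exact Hq. }
  assert (Hr0 : forall n, 0 < r n) by (intros n; exact (proj2_sig (s n))).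
  assert (Hnest : forall n k, norm (minus (y (k + n)%nat) (y n)) <= r n - r (k + n)%nat).
  { intros n k; induction k as [|k IH]; simpl.
    - replace (minus (y n) (y n)) with (zero : V) by vec.
      rewrite norm_zero_eq; vlra.
    - apply Rle_trans with (1 := norm_between _ (y (k + n)%nat) _).
      destruct (Hs (k + n)%nat) as [H1 [H2 _]]; vlra. }
  assert (Hr : forall n, r n <= (/ 2) ^ n).
  { induction n as [|n IH]; [unfold r; simpl; lra|].
    destruct (Hs n) as [H1 _]; simpl; vlra. }
  assert (Hball : forall n, eventually (fun m => norm (minus (y m) (y n)) <= r n)).
  { intros n; exists n; intros m Hm; replace m with ((m - n) + n)%nat by lia.
    pose proof (Hnest n (m - n)%nat) as H1; pose proof (Hr0 (m - n + n)%nat); vlra. }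
  destruct (cauchy_lim eventually y) as [z Hz].
  { intros eps He.
    destruct (pow_lt_1_zero (/ 2) ltac:(rewrite Rabs_pos_eq; lra) (eps / 2) ltac:(lra))
      as [N HN].
    specialize (HN N (Nat.le_refl N)); pose proof (Rle_abs ((/ 2) ^ N)) as HN'.
    exists (fun m => norm (minus (y m) (y N)) <= r N); split; [apply Hball|].
    intros m m' Hm Hm'; apply Rle_lt_trans with (1 := norm_between _ (y N) _).
    rewrite (norm_minus_sym (y N)); specialize (Hr N); vlra. }
  destruct (Hpt z) as [c Hc].
  destruct (nfloor_ex (Rmax c 0) (Rmax_r _ _)) as [n [_ Hn]].
  destruct (Hs (S n)) as [_ [_ [i Hi]]].
  assert (H : INR (S n) <= norm (B i z)).
  { apply Hi; apply (lim_norm_minus_le eventually y); [exact Hz|apply Hball]. }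
  specialize (Hc i); rewrite S_INR in H; pose proof (Rmax_l c 0); vlra.
Qed.

End UniformBoundedness.

(** * Exponentials of bounded operators *)

Section Exponential.
Context {V : CompleteNormedModule R_AbsRing}.
Implicit Types (x y z : V).

(** Partial sums of the scalar exponential series, which dominate those of the operator
    exponential. *)
Definition exp_sum (t : R) (n : nat) : R := sum_n (fun k => t ^ k / INR (fact k)) n.

Lemma exp_sum_lim t : filterlim (exp_sum t) eventually (locally (exp t)).
Proof.
  pose proof (is_exp_Reals t) as H.
  apply filterlim_ext with (2 := H); intros n; unfold exp_sum.
  apply sum_n_ext; intros k; rewrite pow_n_pow; unfold Rdiv; reflexivity.
Qed.

Lemma exp_sum_pow_ge0 t k : 0 <= t -> 0 <= t ^ k / INR (fact k).
Proof.
  intros Ht; apply Rmult_le_pos; [now apply pow_le|].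
  apply Rlt_le, Rinv_0_lt_compat, INR_fact_lt_0.
Qed.

Lemma exp_sum_S t n : exp_sum t (S n) = exp_sum t n + t ^ S n / INR (fact (S n)).
Proof. unfold exp_sum; now rewrite sum_Sn. Qed.

Lemma exp_sum_mono t n m : 0 <= t -> (n <= m)%nat -> exp_sum t n <= exp_sum t m.
Proof.
  intros Ht H; induction H as [|m H IH]; [lra|].
  apply Rle_trans with (1 := IH); rewrite exp_sum_S.
  pose proof (exp_sum_pow_ge0 t (S m) Ht); lra.
Qed.

Lemma exp_sum_le_exp t n : 0 <= t -> exp_sum t n <= exp t.
Proof.
  intros Ht.
  apply (filterlim_le (F := eventually) (fun _ => exp_sum t n) (exp_sum t)
           (Finite (exp_sum t n)) (Finite (exp t))).
  - exists n; intros m Hm; now apply exp_sum_mono.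
  - apply filterlim_const.
  - apply exp_sum_lim.
Qed.

Definition exp_partial (B : V -> V) (t : R) (N : nat) (x : V) : V :=
  sum_n (fun k => scal (t ^ k / INR (fact k)) (Nat.iter k B x)) N.

Definition exp_flow (B : V -> V) (t : R) (x : V) : V :=
  iota (fun y => filterlim (fun N => exp_partial B t N x) eventually (locally y)).

Lemma iter_is_linear (B : V -> V) n : is_linear B -> is_linear (Nat.iter n B).
Proof.
  intros HB; induction n as [|n IH]; [exact is_linear_id|].
  exact (is_linear_comp _ _ IH HB).
Qed.

Lemma iter_norm_le (B : V -> V) b n x :
  0 <= b -> (forall x, norm (B x) <= b * norm x) ->
  norm (Nat.iter n B x) <= b ^ n * norm x.
Proof.
  intros Hb HB; induction n as [|n IH]; [simpl; lra|].
  change (norm (B (Nat.iter n B x)) <= b * b ^ n * norm x).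
  apply Rle_trans with (1 := HB _); rewrite Rmult_assoc.
  now apply Rmult_le_compat_l.
Qed.

Lemma iter_commute (L B : V -> V) n x :
  (forall x, L (B x) = B (L x)) -> L (Nat.iter n B x) = Nat.iter n B (L x).
Proof.
  intros H; induction n as [|n IH]; [reflexivity|].
  simpl; now rewrite H, IH.
Qed.

Lemma iter_scal (B : V -> V) (t : R) n x :
  is_linear B -> Nat.iter n (fun z => scal t (B z)) x = scal (t ^ n) (Nat.iter n B x).
Proof.
  intros HB; induction n as [|n IH]; simpl.
  - vec.
  - rewrite IH, (linear_scal _ HB); vec.
Qed.

Lemma exp_partial_S B t n x :
  exp_partial B t (S n) x =
  plus (exp_partial B t n x) (scal (t ^ S n / INR (fact (S n))) (Nat.iter (S n) B x)).
Proof. unfold exp_partial; now rewrite sum_Sn. Qed.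

Lemma exp_partial_is_linear B t n : is_linear B -> is_linear (exp_partial B t n).
Proof.
  intros HB; induction n as [|n IH].
  - apply is_linear_ext with (fun x => x); [|exact is_linear_id].
    intros x; unfold exp_partial; rewrite sum_O; simpl; rewrite Rdiv_1_r; vec.
  - apply is_linear_ext with (fun x => plus (exp_partial B t n x)
      (scal (t ^ S n / INR (fact (S n))) (Nat.iter (S n) B x))).
    { intros x; now rewrite exp_partial_S. }
    pose proof (is_linear_comp _ _ (iter_is_linear B (S n) HB)
      (is_linear_scal_r (t ^ S n / INR (fact (S n))) Rmult_comm)) as H2.
    exact (is_linear_comp _ _ (is_linear_prod _ _ IH H2) is_linear_plus).
Qed.

Lemma exp_partial_commute (L B : V -> V) t n x :
  is_linear L -> (forall x, L (B x) = B (L x)) ->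
  L (exp_partial B t n x) = exp_partial B t n (L x).
Proof.
  intros HL HC; induction n as [|n IH].
  - unfold exp_partial; rewrite !sum_O; exact (linear_scal _ HL _ _).
  - rewrite !exp_partial_S, (linear_plus _ HL), (linear_scal _ HL), IH.
    now rewrite (iter_commute L B).
Qed.

Section PowerBounded.
Context (B : V -> V) (M b : R) (HM : 0 <= M) (Hb : 0 <= b)
  (HMb : forall n x, norm (Nat.iter n B x) <= M * b ^ n * norm x).

(** The constant M is carried separately from the rate b because the powers of a
    resolvent satisfy |B^n| <= M b^n without |B| <= b. *)
Lemma exp_partial_diff_le t n m x : (n <= m)%nat ->
  norm (minus (exp_partial B t m x) (exp_partial B t n x)) <=
  M * (exp_sum (Rabs t * b) m - exp_sum (Rabs t * b) n) * norm x.
Proof.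
  intros H; induction H as [|m H IH].
  - replace (minus (exp_partial B t n x) (exp_partial B t n x)) with (zero : V) by vec.
    simpl_norm_zero; lra.
  - rewrite exp_partial_S; rewrite exp_sum_S.
    set (T := scal _ _).
    replace (minus (plus (exp_partial B t m x) T) (exp_partial B t n x))
      with (plus (minus (exp_partial B t m x) (exp_partial B t n x)) T) by vec.
    apply Rle_trans with (1 := norm_plus_le _ _).
    assert (HT : norm T <= M * ((Rabs t * b) ^ S m / INR (fact (S m))) * norm x).
    { unfold T; simpl_norm_scal; unfold Rdiv; rewrite Rabs_mult, <- RPow_abs, (Rabs_pos_eq (/ _)).
      2:{ apply Rlt_le, Rinv_0_lt_compat, INR_fact_lt_0. }
      rewrite Rpow_mult_distr.
      apply Rle_trans with (Rabs t ^ S m * / INR (fact (S m)) * (M * b ^ S m * norm x)).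
      - apply Rmult_le_compat_l; [|apply HMb].
        apply (exp_sum_pow_ge0 (Rabs t) (S m)), Rabs_pos.
      - right; ring. }
    vec_canon_norms; lra.
Qed.

Lemma abs_mult_rate_ge0 t : 0 <= Rabs t * b.
Proof using Hb. apply Rmult_le_pos; [apply Rabs_pos|exact Hb]. Qed.

Lemma exp_partial_norm_le t n x :
  norm (exp_partial B t n x) <= M * exp (Rabs t * b) * norm x.
Proof.
  pose proof (exp_partial_diff_le t 0 n x ltac:(lia)) as H.
  pose proof (exp_sum_le_exp _ n (abs_mult_rate_ge0 t)) as H1.
  pose proof (norm_le_minus (exp_partial B t n x) (exp_partial B t 0 x)) as H2.
  assert (H0 : norm (exp_partial B t 0 x) <= M * norm x).
  { unfold exp_partial; rewrite sum_O; simpl_norm_scal; simpl.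
    rewrite Rdiv_1_r, Rabs_R1, Rmult_1_l.
    pose proof (HMb 0 x) as H3; simpl in H3; lra. }
  assert (E0 : exp_sum (Rabs t * b) 0 = 1) by (unfold exp_sum; rewrite sum_O; simpl; lra).
  rewrite E0 in H.
  assert (M * exp_sum (Rabs t * b) n * norm x <= M * exp (Rabs t * b) * norm x).
  { apply Rmult_le_compat_r; [apply norm_ge_0|]; now apply Rmult_le_compat_l. }
  vlra.
Qed.

Lemma exp_flow_lim_power_bounded t x :
  filterlim (fun N => exp_partial B t N x) eventually (locally (exp_flow B t x)).
Proof.
  destruct (cauchy_lim eventually (fun N => exp_partial B t N x)) as [y Hy].
  - intros eps He.
    set (k := M * norm x + 1).
    assert (Hk : 0 < k).
    { pose proof (Rmult_le_pos _ _ HM (norm_ge_0 x)); unfold k; lra. }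
    assert (Hek : 0 < eps / (4 * k)) by (apply Rdiv_lt_0_compat; lra).
    destruct (proj1 (lim_norm (V := R_CompleteNormedModule) eventually _ _)
      (exp_sum_lim (Rabs t * b)) _ Hek) as [N HN].
    exists (fun n => (N <= n)%nat); split; [now exists N|].
    assert (Hwlog : forall n m, (N <= n)%nat -> (n <= m)%nat ->
      norm (minus (exp_partial B t m x) (exp_partial B t n x)) < eps).
    { intros n m Hn Hm; apply Rle_lt_trans with (1 := exp_partial_diff_le t n m x Hm).
      assert (Hn' := HN n Hn); assert (Hm' := HN m ltac:(lia)).
      change (Rabs (exp_sum (Rabs t * b) n - exp (Rabs t * b)) < eps / (4 * k)) in Hn'.
      change (Rabs (exp_sum (Rabs t * b) m - exp (Rabs t * b)) < eps / (4 * k)) in Hm'.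
      apply Rabs_def2 in Hn'; apply Rabs_def2 in Hm'.
      pose proof (exp_sum_mono _ n m (abs_mult_rate_ge0 t) Hm) as Hnm.
      set (d := exp_sum (Rabs t * b) m - exp_sum (Rabs t * b) n) in *.
      apply Rle_lt_trans with (k * d).
      - replace (M * d * norm x) with (M * norm x * d) by ring.
        apply Rmult_le_compat_r; unfold d, k; lra.
      - apply Rle_lt_trans with (k * (eps / (2 * k))).
        + apply Rmult_le_compat_l; [lra|].
          replace (eps / (2 * k)) with (2 * (eps / (4 * k))) by (field; lra).
          unfold d; lra.
        + replace (k * (eps / (2 * k))) with (eps / 2) by (field; lra); lra. }
    intros n m Hn Hm; destruct (Nat.le_ge_cases n m) as [H|H].
    + rewrite norm_minus_sym; now apply Hwlog.
    + now apply Hwlog.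
  - replace (exp_flow B t x) with y; [exact Hy|]; symmetry.
    refine (iota_filterlim_locally (F := eventually) _ y Hy).
Qed.

Lemma exp_flow_tail t n x :
  norm (minus (exp_partial B t n x) (exp_flow B t x)) <=
  M * (exp (Rabs t * b) - exp_sum (Rabs t * b) n) * norm x.
Proof.
  rewrite norm_minus_sym.
  apply (lim_norm_minus_le eventually (fun N => exp_partial B t N x)); [apply exp_flow_lim_power_bounded|].
  exists n; intros m Hm; apply Rle_trans with (1 := exp_partial_diff_le t n m x Hm).
  apply Rmult_le_compat_r; [apply norm_ge_0|]; apply Rmult_le_compat_l; [exact HM|].
  pose proof (exp_sum_le_exp _ m (abs_mult_rate_ge0 t)); lra.
Qed.

Lemma exp_flow_norm_le t x : norm (exp_flow B t x) <= M * exp (Rabs t * b) * norm x.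
Proof.
  apply (lim_norm_le eventually (fun N => exp_partial B t N x)); [apply exp_flow_lim_power_bounded|].
  exists 0%nat; intros; apply exp_partial_norm_le.
Qed.

Definition exp_partial_derive (t : R) (N : nat) (x : V) : V :=
  match N with O => zero | S n => exp_partial B t n (B x) end.

Lemma is_derive_exp_partial t N x :
  is_derive (fun t => exp_partial B t N x) t (exp_partial_derive t N x).
Proof.
  induction N as [|N IH].
  - apply is_derive_ext with (fun _ => x); [|exact (is_derive_const x t)].
    intros s; unfold exp_partial; rewrite sum_O; simpl; rewrite Rdiv_1_r; vec.
  - apply is_derive_ext with (fun t => plus (exp_partial B t N x)
       (scal (t ^ S N / INR (fact (S N))) (Nat.iter (S N) B x))).
    { intros s; now rewrite exp_partial_S. }
    replace (exp_partial_derive t (S N) x)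
      with (plus (exp_partial_derive t N x)
             (scal (t ^ N / INR (fact N)) (Nat.iter N B (B x)))).
    2:{ destruct N as [|N]; simpl exp_partial_derive.
        - unfold exp_partial; rewrite sum_O; simpl; vec.
        - now rewrite exp_partial_S. }
    refine (is_derive_plus (V := V) _ _ _ _ _ IH _).
    rewrite <- Nat.iter_succ_r.
    refine (is_derive_scal_l (V := V) _ _ _ _ _).
    auto_derive; [trivial|].
    change (match N with O => 1 | S _ => INR N + 1 end) with (INR (S N)).
    change (fact N + N * fact N)%nat with (S N * fact N)%nat; rewrite mult_INR.
    field; split; [apply INR_fact_neq_0|apply not_0_INR; lia].
Qed.

Lemma exp_partial_derive_norm_le t r N x : Rabs t <= r ->
  norm (exp_partial_derive t N x) <= M * exp (r * b) * norm (B x).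
Proof.
  intros Hr; assert (0 <= exp (r * b)) by apply Rlt_le, exp_pos.
  destruct N as [|N]; simpl.
  - simpl_norm_zero; repeat apply Rmult_le_pos; try assumption; apply norm_ge_0.
  - apply Rle_trans with (1 := exp_partial_norm_le t N (B x)).
    apply Rmult_le_compat_r; [apply norm_ge_0|]; apply Rmult_le_compat_l; [exact HM|].
    apply exp_mono; now apply Rmult_le_compat_r.
Qed.

(** The second derivative of a partial sum is again a partial sum, so Taylor's inequality
    holds with a remainder bound independent of the number of terms; it therefore passes
    to the limit, without differentiating a series term by term. *)
Lemma exp_flow_taylor t h x : Rabs h <= 1 ->
  norm (minus (minus (exp_flow B (t + h) x) (exp_flow B t x)) (scal h (exp_flow B t (B x))))
  <= M * exp ((Rabs t + 1) * b) * norm (B (B x)) * Rabs h * Rabs h.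
Proof.
  intros Hh; set (k := M * exp ((Rabs t + 1) * b) * norm (B (B x))).
  assert (Hs : forall s, Rmin t (t + h) <= s <= Rmax t (t + h) ->
            Rabs s <= Rabs t + 1 /\ Rabs (s - t) <= Rabs h).
  { intros s; unfold Rmin, Rmax, Rabs in *; repeat destruct Rle_dec; repeat destruct Rcase_abs;
      lra. }
  assert (HK : forall N s, Rmin t (t + h) <= s <= Rmax t (t + h) ->
     norm (minus (exp_partial_derive s N x) (exp_partial_derive t N x)) <= k * Rabs h).
  { intros N s Hsh; destruct (Hs s Hsh) as [_ Hs2].
    assert (Hk : 0 <= k).
    { unfold k; repeat apply Rmult_le_pos; try assumption; [apply Rlt_le, exp_pos|apply norm_ge_0]. }
    apply Rle_trans with (k * Rabs (s - t)); [|now apply Rmult_le_compat_l].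
    destruct N as [|N]; simpl exp_partial_derive.
    - apply Rle_trans with 0.
      { right; transitivity (norm (zero : V)); [f_equal; vec|exact norm_zero_eq]. }
      apply Rmult_le_pos; [exact Hk|apply Rabs_pos].
    - apply (mean_value_norm_sym (fun s => exp_partial B s N (B x))).
      intros u Hu; exists (exp_partial_derive u N (B x)); split; [apply is_derive_exp_partial|].
      apply exp_partial_derive_norm_le, Hs.
      unfold Rmin, Rmax in *; repeat destruct Rle_dec; lra. }
  refine (lim_norm_le eventually (fun N => minus (minus (exp_partial B (t + h) (S N) x)
    (exp_partial B t (S N) x)) (scal h (exp_partial B t N (B x)))) _ _ _ _).
  - assert (HS : filterlim S eventually eventually).
    { intros P [N HN]; exists N; intros n Hn; apply HN; lia. }
    apply lim_minus; [exact _| |apply lim_scal; [exact _|apply exp_flow_lim_power_bounded]].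
    apply lim_minus; [exact _| |].
    + exact (filterlim_comp _ _ _ _ _ _ _ _ HS (exp_flow_lim_power_bounded (t + h) x)).
    + exact (filterlim_comp _ _ _ _ _ _ _ _ HS (exp_flow_lim_power_bounded t x)).
  - exists 0%nat; intros N _.
    pose (f := fun s => minus (exp_partial B s (S N) x) (scal s (exp_partial_derive t (S N) x))).
    assert (Hf : norm (minus (f (t + h)) (f t)) <= k * Rabs h * Rabs (t + h - t)).
    { apply mean_value_norm_sym; intros s Hsh.
      exists (minus (exp_partial_derive s (S N) x) (exp_partial_derive t (S N) x)).
      split; [|now apply HK].
      refine (is_derive_minus (V := V) _ _ _ _ _ (is_derive_exp_partial s (S N) x) _).
      exact (is_derive_scal_id s _). }
    replace (t + h - t) with h in Hf by ring.
    apply Rle_trans with (2 := Hf); right; f_equal; unfold f; simpl exp_partial_derive; vec.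
Qed.

End PowerBounded.

Section Linear.
Context (B : V -> V) (HB : is_linear B).

Lemma linear_power_bounded : exists b, 0 <= b /\
  forall n x, norm (Nat.iter n B x) <= 1 * b ^ n * norm x.
Proof.
  destruct (linear_norm _ HB) as [b [Hb Hn]]; exists b; split; [lra|].
  intros n x; rewrite Rmult_1_l; apply iter_norm_le; [lra|exact Hn].
Qed.

Lemma exp_flow_lim t x :
  filterlim (fun N => exp_partial B t N x) eventually (locally (exp_flow B t x)).
Proof.
  destruct linear_power_bounded as [b [Hb Hn]].
  exact (exp_flow_lim_power_bounded B 1 b Rle_0_1 Hb Hn t x).
Qed.

Lemma exp_flow_locally_bounded r : exists c, 0 <= c /\
  forall t x, Rabs t <= r -> norm (exp_flow B t x) <= c * norm x.
Proof.
  destruct linear_power_bounded as [b [Hb Hn]].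
  exists (1 * exp (r * b)); split; [pose proof (exp_pos (r * b)); lra|].
  intros t x Ht; apply Rle_trans with (1 := exp_flow_norm_le B 1 b Rle_0_1 Hb Hn t x).
  apply Rmult_le_compat_r; [apply norm_ge_0|].
  rewrite !Rmult_1_l; apply exp_mono; now apply Rmult_le_compat_r.
Qed.

Lemma exp_flow_is_linear t : is_linear (exp_flow B t).
Proof.
  split.
  - intros x y; apply (lim_unique eventually (fun N => exp_partial B t N (plus x y))).
    + apply exp_flow_lim.
    + apply filterlim_ext with (fun N => plus (exp_partial B t N x) (exp_partial B t N y)).
      * intros N; symmetry; exact (linear_plus _ (exp_partial_is_linear B t N HB) x y).
      * apply lim_plus; [exact _| |]; apply exp_flow_lim.
  - intros k x; apply (lim_unique eventually (fun N => exp_partial B t N (scal k x))).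
    + apply exp_flow_lim.
    + apply filterlim_ext with (fun N => scal k (exp_partial B t N x)).
      * intros N; symmetry; exact (linear_scal _ (exp_partial_is_linear B t N HB) k x).
      * apply lim_scal; [exact _|]; apply exp_flow_lim.
  - destruct (exp_flow_locally_bounded (Rabs t)) as [c [Hc Hn]].
    exists (c + 1); split; [lra|].
    intros x; apply Rle_trans with (1 := Hn t x (Rle_refl _)).
    apply Rmult_le_compat_r; [apply norm_ge_0|lra].
Qed.

Lemma exp_flow_commute (L : V -> V) t x :
  is_linear L -> (forall x, L (B x) = B (L x)) ->
  L (exp_flow B t x) = exp_flow B t (L x).
Proof.
  intros HL HC; apply (lim_unique eventually (fun N => L (exp_partial B t N x))).
  - apply (lim_linear eventually L); [exact HL|apply exp_flow_lim].
  - apply filterlim_ext with (fun N => exp_partial B t N (L x)).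
    + intros N; symmetry; now apply exp_partial_commute.
    + apply exp_flow_lim.
Qed.

Lemma exp_flow_0 x : exp_flow B 0 x = x.
Proof.
  apply (lim_unique eventually (fun N => exp_partial B 0 N x)); [apply exp_flow_lim|].
  apply filterlim_ext with (fun _ => x); [|apply filterlim_const].
  intros N; induction N as [|N IH].
  - unfold exp_partial; rewrite sum_O; simpl; rewrite Rdiv_1_r; vec.
  - rewrite exp_partial_S, <- IH, pow_i by lia; unfold Rdiv; vec.
Qed.

Lemma is_derive_exp_flow t x :
  is_derive (fun t => exp_flow B t x) t (exp_flow B t (B x)).
Proof.
  destruct linear_power_bounded as [b [Hb Hn]].
  assert (HM := Rle_0_1); set (M := 1) in Hn, HM.
  apply is_derive_norm; intros eps He.
  set (k := M * exp ((Rabs t + 1) * b) * norm (B (B x))).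
  assert (Hk : 0 <= k).
  { unfold k; repeat apply Rmult_le_pos; try assumption; [apply Rlt_le, exp_pos|apply norm_ge_0]. }
  exists (Rmin 1 (eps / (k + 1))); split.
  { apply Rmin_glb_lt; [lra|apply Rdiv_lt_0_compat; lra]. }
  intros h Hh.
  assert (H1 := Rlt_le_trans _ _ _ Hh (Rmin_l _ _)).
  assert (H2 := Rlt_le_trans _ _ _ Hh (Rmin_r _ _)).
  apply Rle_trans with (1 := exp_flow_taylor B M b HM Hb Hn t h x (Rlt_le _ _ H1)).
  fold k; apply Rmult_le_compat_r; [apply Rabs_pos|].
  apply Rmult_lt_compat_l with (r := k + 1) in H2; [|lra].
  replace ((k + 1) * (eps / (k + 1))) with eps in H2 by (field; lra).
  pose proof (Rabs_pos h); lra.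
Qed.

(** An approximate solution of v' = B v stays close to the exact one: the function
    s |-> e^{(t-s)B} v(s) joins e^{tB} v(0) to v(t), and its derivative is
    e^{(t-s)B} r(s). *)
Lemma exp_flow_duhamel (v r : R -> V) (t c : R) :
  0 <= t ->
  (forall s, 0 <= s <= t -> is_derive v s (plus (B (v s)) (r s))) ->
  (forall s, 0 <= s <= t -> norm (exp_flow B (t - s) (r s)) <= c) ->
  norm (minus (v t) (exp_flow B t (v 0))) <= c * t.
Proof.
  intros Ht Hv Hr.
  replace (v t) with (exp_flow B (t - t) (v t)) by (now rewrite Rminus_diag, exp_flow_0).
  replace (exp_flow B t) with (exp_flow B (t - 0)) by (now rewrite Rminus_0_r).
  replace (c * t) with (c * (t - 0)) by ring.
  apply (mean_value_norm_const (fun s => exp_flow B (t - s) (v s))); [exact Ht|].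
  intros s Hs; exists (exp_flow B (t - s) (r s)); split; [|now apply Hr].
  replace (exp_flow B (t - s) (r s))
    with (plus (opp (exp_flow B (t - s) (B (v s)))) (exp_flow B (t - s) (plus (B (v s)) (r s)))).
  2:{ rewrite (linear_plus _ (exp_flow_is_linear (t - s))); vec. }
  destruct (exp_flow_locally_bounded (Rabs (t - s) + 1)) as [k [Hk Hbd]].
  apply (is_derive_apply (fun u => exp_flow B (t - u)) (fun y => opp (exp_flow B (t - s) (B y)))
           v s k).
  - intros u; apply exp_flow_is_linear.
  - exists (mkposreal 1 Rlt_0_1); intros u Hu y.
    apply Hbd; change (Rabs (u - s) < 1) in Hu; unfold Rabs in *; repeat destruct Rcase_abs; lra.
  - intros y.
    replace (opp (exp_flow B (t - s) (B y))) with (scal (-1) (exp_flow B (t - s) (B y))) by vec.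
    refine (is_derive_comp (V := V) (fun u => exp_flow B u y) (fun u => t - u) s _ _ _ _).
    + apply is_derive_exp_flow.
    + auto_derive; [trivial|ring].
  - now apply Hv.
Qed.

Lemma exp_flow_unique (v : R -> V) (t : R) :
  0 <= t -> (forall s, 0 <= s <= t -> is_derive v s (B (v s))) ->
  v t = exp_flow B t (v 0).
Proof.
  intros Ht Hv; apply eq_of_norm_small; intros eps He.
  apply Rle_trans with (0 * t); [|lra].
  apply (exp_flow_duhamel v (fun _ => zero)); [exact Ht| |].
  - intros s Hs; replace (plus (B (v s)) zero) with (B (v s)) by vec; now apply Hv.
  - intros s _; apply Rle_trans with (norm (zero : V)); [|simpl_norm_zero; lra].
    right; f_equal; exact (linear_zero _ (exp_flow_is_linear (t - s))).
Qed.

(** As functions of t both sides solve u' = B u with the same initial value. *)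
Lemma exp_flow_plus t s x : 0 <= t -> exp_flow B (t + s) x = exp_flow B t (exp_flow B s x).
Proof.
  intros Ht; replace (exp_flow B s x) with (exp_flow B (0 + s) x) by (now rewrite Rplus_0_l).
  apply (exp_flow_unique (fun t => exp_flow B (t + s) x)); [exact Ht|].
  intros u _; rewrite (exp_flow_commute B) by auto.
  replace (exp_flow B (u + s) (B x)) with (scal 1 (exp_flow B (u + s) (B x))) by vec.
  refine (is_derive_comp (V := V) (fun u => exp_flow B u x) (fun u => u + s) u _ _ _ _).
  - apply is_derive_exp_flow.
  - auto_derive; [trivial|ring].
Qed.

End Linear.

Lemma exp_flow_scal_is_derive (B : V -> V) (HB : is_linear B) (a c t : R) x :
  is_derive (fun s => scal (exp (a * s)) (exp_flow (fun z => scal c (B z)) s x)) t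
    (plus (scal c (B (scal (exp (a * t)) (exp_flow (fun z => scal c (B z)) t x))))
       (scal a (scal (exp (a * t)) (exp_flow (fun z => scal c (B z)) t x)))).
Proof.
  assert (HcB : is_linear (fun z => scal c (B z))).
  { exact (is_linear_comp _ _ HB (is_linear_scal_r c Rmult_comm)). }
  set (E := exp_flow (fun z => scal c (B z))) in *.
  apply is_derive_eq with
    (plus (scal (a * exp (a * t)) (E t x)) (scal (exp (a * t)) (E t (scal c (B x))))).
  { apply (is_derive_exp_scal a (fun s => E s x)); exact (is_derive_exp_flow _ HcB t x). }
  pose proof (exp_flow_commute _ HcB _ t x HcB (fun z => eq_refl)) as H.
  cbv beta in H; fold E in H; rewrite <- H, (linear_scal _ HB); vec.
Qed.

End Exponential.

(** * Strongly continuous semigroups and the Laplace transform *)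

Section Semigroups.
Context {V : CompleteNormedModule R_AbsRing}.
Implicit Types (x y z : V).

(** Only real linearity is recorded: right linearity is one more commutation property. *)
Record c0_semigroup (T : R -> V -> V) : Prop := {
  c0_linear : forall t, 0 <= t -> is_linear (T t);
  c0_add : forall t s x, 0 <= t -> 0 <= s -> T (t + s) x = T t (T s x);
  c0_zero : forall x, T 0 x = x;
  c0_continuous : forall x, continuous_on (fun t : R => 0 <= t) (fun t : R => T t x)
}.

(** The pairs (x, y) in the graph of the generator. *)
Definition gen_lim (T : R -> V -> V) (x y : V) : Prop :=
  filterlim (fun h : R => scal (/ h) (minus (T h x) x)) (at_right 0) (locally y).

Lemma gen_lim_unique T x y y' : gen_lim T x y -> gen_lim T x y' -> y = y'.
Proof. exact (lim_unique (at_right 0) _ y y'). Qed.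

Lemma continuous_comp_abs (f : R -> V) (t : R) :
  continuous_on (fun s : R => 0 <= s) f -> continuous (fun s => f (Rabs s)) t.
Proof.
  intros Hf; refine (filterlim_comp _ _ _ Rabs f _ _ _ _ (Hf (Rabs t) (Rabs_pos t))).
  intros P HP; unfold within in HP.
  pose proof (continuous_Rabs t _ HP) as H; unfold filtermap in *.
  apply filter_imp with (2 := H); intros s Hs; apply Hs, Rabs_pos.
Qed.

(** By the semigroup law T(t + h) x - T(t) x = T(t) (T(h) x - x) for h >= 0, and T(t) is
    bounded uniformly for t in a bounded interval; this covers both one-sided limits. *)
Lemma c0_semigroup_of_continuous_at_0 (T : R -> V -> V) (M w : R) :
  0 <= M ->
  (forall t, 0 <= t -> is_linear (T t)) ->
  (forall t s x, 0 <= t -> 0 <= s -> T (t + s) x = T t (T s x)) ->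
  (forall x, T 0 x = x) ->
  (forall t x, 0 <= t -> norm (T t x) <= M * exp (w * t) * norm x) ->
  (forall x eps, 0 < eps -> exists d, 0 < d /\
     forall s, 0 <= s <= d -> norm (minus (T s x) x) <= eps) ->
  c0_semigroup T.
Proof.
  intros HM HL Hadd H0 Hb Hc; split; [exact HL|exact Hadd|exact H0|].
  intros x t Ht; apply lim_norm; [exact _|]; intros eps He.
  set (k := M * exp (Rabs w * (t + 1)) + 1).
  assert (Hk : 0 < k).
  { pose proof (Rmult_le_pos _ _ HM (Rlt_le _ _ (exp_pos (Rabs w * (t + 1))))); unfold k; lra. }
  assert (HTk : forall s y, 0 <= s <= t + 1 -> norm (T s y) <= k * norm y).
  { intros s y Hs; apply Rle_trans with (1 := Hb s y ltac:(lra)).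
    apply Rmult_le_compat_r; [apply norm_ge_0|].
    apply Rle_trans with (M * exp (Rabs w * (t + 1))); [|unfold k; lra].
    apply Rmult_le_compat_l; [exact HM|]; apply exp_mono.
    apply Rle_trans with (Rabs w * s).
    - apply Rmult_le_compat_r; [lra|apply Rle_abs].
    - apply Rmult_le_compat_l; [apply Rabs_pos|lra]. }
  destruct (Hc x (eps / 2 / k)) as [d [Hd H]]; [apply Rdiv_lt_0_compat; lra|].
  assert (Hd' : 0 < Rmin 1 d) by (apply Rmin_glb_lt; lra).
  exists (mkposreal _ Hd'); intros s Hs Hs0.
  change (Rabs (s - t) < Rmin 1 d) in Hs.
  pose proof (Rlt_le_trans _ _ _ Hs (Rmin_l _ _)) as Hs1.
  pose proof (Rlt_le_trans _ _ _ Hs (Rmin_r _ _)) as Hs2.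
  assert (Hstep : forall u h, 0 <= u <= t + 1 -> 0 <= h <= d ->
            norm (minus (T (u + h) x) (T u x)) <= eps / 2).
  { intros u h Hu Hh; rewrite Hadd, <- (linear_minus _ _ _ (HL u ltac:(lra))) by lra.
    apply Rle_trans with (1 := HTk u _ Hu).
    replace (eps / 2) with (k * (eps / 2 / k)) by (field; lra).
    apply Rmult_le_compat_l; [lra|now apply H]. }
  apply Rle_lt_trans with (eps / 2); [|lra].
  apply Rabs_def2 in Hs1; apply Rabs_def2 in Hs2.
  destruct (Rle_lt_dec t s) as [Hts|Hts].
  - replace s with (t + (s - t)) by ring; apply Hstep; lra.
  - rewrite norm_minus_sym; replace t with (s + (t - s)) at 1 by ring; apply Hstep; lra.
Qed.

Section Semigroup.
Context (T : R -> V -> V) (HT : c0_semigroup T).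

Lemma c0_locally_bounded x : exists c, forall t, 0 <= t <= 1 -> norm (T t x) <= c.
Proof.
  destruct (continuity_ab_maj (fun t => norm (T (Rabs t) x)) 0 1 Rle_0_1) as [m [Hm _]].
  - intros t Ht; apply continuity_pt_filterlim.
    refine (filterlim_comp _ _ _ (fun t => T (Rabs t) x) norm _ _ _ _ (filterlim_norm _)).
    apply (continuous_comp_abs (fun t => T t x)), c0_continuous, HT.
  - exists (norm (T (Rabs m) x)); intros t Ht; specialize (Hm t Ht).
    now rewrite (Rabs_pos_eq t) in Hm by lra.
Qed.

(** If M > 1 bounds |T(t)| on [0, 1], then splitting off unit steps gives
    |T(t)| <= M^{1 + t} = M e^{t ln M}. *)
Lemma c0_growth_bound : exists M w, 1 < M /\
  forall t x, 0 <= t -> norm (T t x) <= M * exp (t * w) * norm x.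
Proof.
  (* Clipping makes the whole line an index set for the operators of [0, 1]. *)
  assert (Hclip : forall s, 0 <= Rmax 0 (Rmin 1 s) <= 1).
  { intros s; unfold Rmax, Rmin; repeat destruct Rle_dec; lra. }
  destruct (uniform_boundedness (fun s => T (Rmax 0 (Rmin 1 s)))) as [c Hc].
  { intros s; apply (c0_linear T HT), Hclip. }
  { intros x; destruct (c0_locally_bounded x) as [c Hc]; exists c.
    intros s; apply Hc, Hclip. }
  set (M := Rmax c 2).
  assert (HM2 : 2 <= M) by apply Rmax_r.
  assert (HM1 : forall t x, 0 <= t <= 1 -> norm (T t x) <= M * norm x).
  { intros t x Ht; specialize (Hc t x).
    rewrite Rmin_right, Rmax_right in Hc by lra.
    apply Rle_trans with (1 := Hc), Rmult_le_compat_r; [apply norm_ge_0|apply Rmax_l]. }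
  exists M, (ln M); split; [lra|].
  assert (Hln : 0 < ln M) by (rewrite <- ln_1; apply ln_increasing; lra).
  assert (Hn : forall n t x, 0 <= t <= INR (S n) ->
            norm (T t x) <= M * exp (t * ln M) * norm x).
  { intros n; induction n as [|n IH]; intros t x Ht.
    - apply Rle_trans with (1 := HM1 t x Ht), Rmult_le_compat_r; [apply norm_ge_0|].
      rewrite <- (Rmult_1_r M) at 1; apply Rmult_le_compat_l; [lra|].
      rewrite <- exp_0; apply exp_mono, Rmult_le_pos; lra.
    - destruct (Rle_lt_dec t 1) as [H1|H1].
      + apply IH; split; [lra|]; rewrite S_INR; pose proof (pos_INR n); lra.
      + replace (T t x) with (T (t - 1) (T 1 x)).
        2:{ rewrite <- (c0_add T HT) by lra; f_equal; ring. }
        rewrite S_INR in Ht.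
        apply Rle_trans with (1 := IH (t - 1) (T 1 x) ltac:(lra)).
        replace (exp (t * ln M)) with (exp ((t - 1) * ln M) * M).
        2:{ rewrite <- (exp_ln M) at 2 by lra; rewrite <- exp_plus; f_equal; ring. }
        rewrite !Rmult_assoc; apply Rmult_le_compat_l; [lra|].
        apply Rmult_le_compat_l; [apply Rlt_le, exp_pos|].
        apply HM1; lra. }
  intros t x Ht; destruct (nfloor_ex t Ht) as [n [_ Hn']].
  apply (Hn n); rewrite S_INR; lra.
Qed.

Lemma gen_lim_plus x y x' y' :
  gen_lim T x y -> gen_lim T x' y' -> gen_lim T (plus x x') (plus y y').
Proof.
  intros H H'.
  refine (filterlim_within_ext _ _ _ _ (lim_plus (at_right 0) _ _ _ _ H H')).
  intros h Hh; rewrite (linear_plus _ (c0_linear T HT h (Rlt_le _ _ Hh))); vec.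
Qed.

Lemma gen_lim_linear (L : V -> V) x y : is_linear L ->
  (forall t z, 0 <= t -> L (T t z) = T t (L z)) -> gen_lim T x y -> gen_lim T (L x) (L y).
Proof.
  intros HL HC H.
  refine (filterlim_within_ext _ _ _ _ (lim_linear (at_right 0) L _ _ HL H)).
  intros h Hh; rewrite (linear_scal _ HL), (linear_minus _ _ _ HL), HC; [reflexivity|].
  now apply Rlt_le.
Qed.

Lemma gen_lim_scal (r : R) x y : gen_lim T x y -> gen_lim T (scal r x) (scal r y).
Proof.
  apply (gen_lim_linear (fun z => scal r z) x y (is_linear_scal_r r Rmult_comm)).
  intros t z Ht; symmetry; exact (linear_scal _ (c0_linear T HT t Ht) r z).
Qed.

(** Only right difference quotients of an orbit are available a priori, but when the
    orbit of z coincides on [0, oo) with a function differentiable at 0, that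
    derivative is the value of the generator at z. *)
Lemma gen_lim_of_derive (f : R -> V) z y :
  (forall h, 0 <= h -> T h z = f h) -> is_derive f 0 y -> gen_lim T z y.
Proof.
  intros Hf Hd; apply lim_norm; [exact _|]; intros eps He.
  destruct (proj1 (is_derive_norm f 0 y) Hd (eps / 2) ltac:(lra)) as [d [Hd0 H]].
  exists (mkposreal d Hd0); intros h Hh Hh0.
  change (Rabs (h - 0) < d) in Hh; rewrite Rminus_0_r in Hh.
  specialize (H h Hh); rewrite Rplus_0_l in H.
  rewrite <- (Hf h), <- (Hf 0), (c0_zero T HT) in H by lra.
  apply Rle_lt_trans with (eps / 2); [|lra].
  norm_replace (scal (/ h) (minus (minus (T h z) z) (scal h y))).
  2:{ vec_field; lra. }
  simpl_norm_scal; rewrite Rabs_pos_eq by (apply Rlt_le, Rinv_0_lt_compat; lra).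
  rewrite (Rabs_pos_eq h) in H by lra.
  apply Rmult_le_compat_l with (r := / h) in H;
    [|apply Rlt_le, Rinv_0_lt_compat; lra].
  replace (/ h * (eps / 2 * h)) with (eps / 2) in H by (field; lra); exact H.
Qed.

Section PartialLaplace.
Context (l : R).

Definition laplace_integrand (x : V) (s : R) : V := scal (exp (- (s * l))) (T (Rabs s) x).

(** T is only controlled on [0, oo), hence the absolute value in the integrand: it makes
    the integrand continuous on the whole line, so that the integral is differentiable at
    0 as well. *)
Definition laplace_partial (t : R) (x : V) : V := RInt (laplace_integrand x) 0 t.

Lemma continuous_laplace_integrand x t : continuous (laplace_integrand x) t.
Proof.
  apply (continuous_scal (V := V)).
  - apply (ex_derive_continuous (fun s => exp (- (s * l)))); auto_derive; trivial.
  - apply (continuous_comp_abs (fun s => T s x)), c0_continuous, HT.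
Qed.

Lemma is_RInt_laplace x t : is_RInt (laplace_integrand x) 0 t (laplace_partial t x).
Proof.
  apply RInt_correct, ex_RInt_continuous; intros; apply continuous_laplace_integrand.
Qed.

Lemma is_derive_laplace_partial x t :
  is_derive (fun t => laplace_partial t x) t (laplace_integrand x t).
Proof.
  apply (is_derive_RInt _ _ 0); [|apply continuous_laplace_integrand].
  exists (mkposreal 1 Rlt_0_1); intros s _; apply is_RInt_laplace.
Qed.

Lemma laplace_partial_0 x : laplace_partial 0 x = zero.
Proof. exact (RInt_point 0 (laplace_integrand x)). Qed.

Lemma laplace_partial_plus t x y : 0 <= t ->
  laplace_partial t (plus x y) = plus (laplace_partial t x) (laplace_partial t y).
Proof.
  intros Ht.
  apply (eq_of_derive_eq (fun t => laplace_partial t (plus x y))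
    (fun t => plus (laplace_partial t x) (laplace_partial t y))); [exact Ht| |].
  - intros s _; exists (laplace_integrand (plus x y) s); split; [apply is_derive_laplace_partial|].
    replace (laplace_integrand (plus x y) s)
      with (plus (laplace_integrand x s) (laplace_integrand y s)).
    2:{ unfold laplace_integrand; rewrite (linear_plus _ (c0_linear T HT _ (Rabs_pos s))); vec. }
    refine (is_derive_plus (V := V) _ _ _ _ _ _ _); apply is_derive_laplace_partial.
  - rewrite !laplace_partial_0; vec.
Qed.

Lemma laplace_partial_commute (L : V -> V) t x : is_linear L -> 0 <= t ->
  (forall t z, 0 <= t -> L (T t z) = T t (L z)) ->
  L (laplace_partial t x) = laplace_partial t (L x).
Proof.
  intros HL Ht HC.
  apply (eq_of_derive_eq (fun t => L (laplace_partial t x))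
    (fun t => laplace_partial t (L x))); [exact Ht| |].
  - intros s _; exists (laplace_integrand (L x) s); split; [|apply is_derive_laplace_partial].
    replace (laplace_integrand (L x) s) with (L (laplace_integrand x s)).
    2:{ unfold laplace_integrand; rewrite (linear_scal _ HL), HC; [reflexivity|apply Rabs_pos]. }
    apply is_derive_linear; [exact HL|apply is_derive_laplace_partial].
  - rewrite !laplace_partial_0; exact (linear_zero _ HL).
Qed.

(** The substitution s |-> s + h in the integral, proved by comparing derivatives in t. *)
Lemma semigroup_laplace_partial h t x : 0 <= h -> 0 <= t ->
  T h (laplace_partial t x) =
  scal (exp (l * h)) (minus (laplace_partial (t + h) x) (laplace_partial h x)).
Proof.
  intros Hh Ht.
  apply (eq_of_derive_eq (fun t => T h (laplace_partial t x))
    (fun t => scal (exp (l * h)) (minus (laplace_partial (t + h) x) (laplace_partial h x))));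
    [exact Ht| |].
  - intros s Hs; exists (T h (laplace_integrand x s)); split.
    { apply is_derive_linear; [now apply (c0_linear T HT)|apply is_derive_laplace_partial]. }
    replace (T h (laplace_integrand x s))
      with (scal (exp (l * h)) (minus (scal 1 (laplace_integrand x (s + h))) zero)).
    2:{ unfold laplace_integrand; rewrite (linear_scal _ (c0_linear T HT h Hh)).
        rewrite !Rabs_pos_eq by lra; rewrite (Rplus_comm s h), (c0_add T HT) by lra.
        replace (exp (- (s * l))) with (exp (l * h) * exp (- ((h + s) * l))).
        2:{ rewrite <- exp_plus; f_equal; ring. }
        vec. }
    apply (is_derive_linear (fun y => scal (exp (l * h)) y)).
    { exact (is_linear_scal_r (exp (l * h)) Rmult_comm). }
    refine (is_derive_minus (V := V) _ _ _ _ _ _ _).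
    + refine (is_derive_comp (V := V) (fun u => laplace_partial u x) (fun u => u + h) s _ _ _ _).
      * apply is_derive_laplace_partial.
      * auto_derive; [trivial|ring].
    + exact (is_derive_const (V := V) (laplace_partial h x) s).
  - rewrite Rplus_0_l, laplace_partial_0; transitivity (zero : V); [|vec].
    exact (linear_zero _ (c0_linear T HT h Hh)).
Qed.

Lemma laplace_integrand_0 x : laplace_integrand x 0 = x.
Proof.
  unfold laplace_integrand; rewrite Rmult_0_l, Ropp_0, exp_0, Rabs_R0, (c0_zero T HT); vec.
Qed.

(** This holds for every real l; the case l = 0 provides a dense set of vectors in the
    domain of the generator. *)
Lemma gen_lim_laplace_partial t x : 0 <= t ->
  gen_lim T (laplace_partial t x)
    (minus (plus (scal l (laplace_partial t x)) (laplace_integrand x t)) x).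
Proof.
  intros Ht.
  apply (gen_lim_of_derive (fun h => scal (exp (l * h))
    (minus (laplace_partial (t + h) x) (laplace_partial h x)))).
  { intros h Hh; now apply semigroup_laplace_partial. }
  replace (minus (plus (scal l (laplace_partial t x)) (laplace_integrand x t)) x)
    with (plus (scal (l * exp (l * 0)) (minus (laplace_partial (t + 0) x) (laplace_partial 0 x)))
           (scal (exp (l * 0)) (minus (scal 1 (laplace_integrand x (t + 0)))
              (laplace_integrand x 0)))).
  2:{ rewrite Rmult_0_r, exp_0, Rplus_0_r, laplace_partial_0, laplace_integrand_0; vec. }
  apply (is_derive_exp_scal l (fun h => minus (laplace_partial (t + h) x) (laplace_partial h x))).
  refine (is_derive_minus (V := V) _ _ _ _ _ _ _).
  - refine (is_derive_comp (V := V) (fun u => laplace_partial u x) (fun u => t + u) 0 _ _ _ _).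
    + apply is_derive_laplace_partial.
    + auto_derive; [trivial|ring].
  - apply is_derive_laplace_partial.
Qed.

End PartialLaplace.

(** The averages (1/t) F(t), with F(t) the integral of T(s) x over [0, t], lie in the
    domain and tend to F'(0) = x. *)
Lemma generator_dense x eps : 0 < eps ->
  exists z y, gen_lim T z y /\ norm (minus z x) < eps.
Proof.
  intros He.
  destruct (proj1 (is_derive_norm _ 0 _) (is_derive_laplace_partial 0 x 0) (eps / 2) ltac:(lra))
    as [d [Hd H]].
  specialize (H (d / 2)); rewrite Rplus_0_l, laplace_partial_0, laplace_integrand_0 in H.
  rewrite Rabs_pos_eq in H by lra; specialize (H ltac:(lra)).
  exists (scal (/ (d / 2)) (laplace_partial 0 (d / 2) x)); eexists; split.
  - apply gen_lim_scal, gen_lim_laplace_partial; lra.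
  - norm_replace (scal (/ (d / 2))
      (minus (minus (laplace_partial 0 (d / 2) x) zero) (scal (d / 2) x))).
    2:{ vec_field; lra. }
    simpl_norm_scal; rewrite Rabs_pos_eq by (apply Rlt_le, Rinv_0_lt_compat; lra).
    apply Rmult_le_compat_l with (r := / (d / 2)) in H;
      [|apply Rlt_le, Rinv_0_lt_compat; lra].
    replace (/ (d / 2) * (eps / 2 * (d / 2))) with (eps / 2) in H by (field; lra).
    vlra.
Qed.

Section Resolvent.
Context (M w : R) (HM : 0 <= M)
  (HMw : forall t x, 0 <= t -> norm (T t x) <= M * exp (w * t) * norm x)
  (l : R) (Hl : w < l).

Lemma laplace_partial_diff_le k x a b : 0 <= a <= b ->
  (forall t, 0 <= t -> norm (T t x) <= k * exp (w * t)) ->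
  norm (minus (laplace_partial l b x) (laplace_partial l a x)) <=
  k / (l - w) * (exp ((w - l) * a) - exp ((w - l) * b)).
Proof.
  intros Hab Hk.
  replace (k / (l - w) * (exp ((w - l) * a) - exp ((w - l) * b)))
    with (- (k / (l - w)) * exp ((w - l) * b) - (- (k / (l - w)) * exp ((w - l) * a))) by ring.
  apply (mean_value_norm (fun t => laplace_partial l t x)
           (fun t => - (k / (l - w)) * exp ((w - l) * t))); [lra|].
  intros t Ht; exists (laplace_integrand l x t), (k * exp ((w - l) * t)).
  split; [apply is_derive_laplace_partial|]; split.
  - auto_derive; [trivial|field; lra].
  - unfold laplace_integrand; simpl_norm_scal; rewrite !Rabs_pos_eq by (try apply Rlt_le, exp_pos; lra).
    replace (exp ((w - l) * t)) with (exp (- (t * l)) * exp (w * t))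
      by (rewrite <- exp_plus; f_equal; ring).
    apply Rle_trans with (exp (- (t * l)) * (k * exp (w * t))); [|right; ring].
    apply Rmult_le_compat_l; [apply Rlt_le, exp_pos|apply Hk; lra].
Qed.

Definition laplace (x : V) : V :=
  iota (fun y => filterlim (fun t => laplace_partial l t x) (Rbar_locally p_infty) (locally y)).

Lemma laplace_lim x :
  filterlim (fun t => laplace_partial l t x) (Rbar_locally p_infty) (locally (laplace x)).
Proof.
  destruct (cauchy_lim (Rbar_locally p_infty) (fun t => laplace_partial l t x)) as [y Hy].
  - intros eps He; set (k := M * norm x).
    assert (Hk : 0 <= k) by (apply Rmult_le_pos; [exact HM|apply norm_ge_0]).
    assert (HTk : forall t, 0 <= t -> norm (T t x) <= k * exp (w * t)).
    { intros t Ht; unfold k; specialize (HMw t x Ht); lra. }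
    set (c := k / (l - w)).
    assert (Hc : 0 <= c) by (apply Rmult_le_pos; [exact Hk|apply Rlt_le, Rinv_0_lt_compat; lra]).
    assert (Hec : 0 < eps / (c + 1)) by (apply Rdiv_lt_0_compat; lra).
    set (a := Rmax 0 (ln (eps / (c + 1)) / (w - l))).
    assert (Ha0 : 0 <= a) by apply Rmax_l.
    assert (Ha : exp ((w - l) * a) <= eps / (c + 1)).
    { rewrite <- (exp_ln _ Hec); apply exp_mono.
      assert (Ha1 : ln (eps / (c + 1)) / (w - l) <= a) by apply Rmax_r.
      apply Rmult_le_compat_neg_l with (r := w - l) in Ha1; [|lra].
      replace ((w - l) * (ln (eps / (c + 1)) / (w - l))) with (ln (eps / (c + 1))) in Ha1
        by (field; lra).
      exact Ha1. }
    exists (fun t => a < t); split; [now exists a|].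
    assert (Hwlog : forall s t, a < s -> s <= t ->
      norm (minus (laplace_partial l t x) (laplace_partial l s x)) < eps).
    { intros s t Hs Hst.
      apply Rle_lt_trans with (1 := laplace_partial_diff_le k x s t ltac:(lra) HTk).
      fold c; pose proof (exp_pos ((w - l) * t)).
      assert (exp ((w - l) * s) <= exp ((w - l) * a)).
      { apply exp_mono, Rmult_le_compat_neg_l; lra. }
      apply Rle_lt_trans with (c * (eps / (c + 1))).
      - apply Rmult_le_compat_l; lra.
      - apply Rlt_le_trans with ((c + 1) * (eps / (c + 1))).
        + apply Rmult_lt_compat_r; lra.
        + right; field; lra. }
    intros s t Hs Ht; destruct (Rle_lt_dec s t) as [H|H].
    + rewrite norm_minus_sym; now apply Hwlog.
    + apply Hwlog; lra.
  - replace (laplace x) with y; [exact Hy|]; symmetry.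
    refine (iota_filterlim_locally (F := Rbar_locally p_infty) _ y Hy).
Qed.

Lemma eventually_nonneg : Rbar_locally p_infty (fun t => 0 <= t).
Proof. exists 0; intros; lra. Qed.

Lemma laplace_norm_le k x : 0 <= k ->
  (forall t, 0 <= t -> norm (T t x) <= k * exp (w * t)) -> norm (laplace x) <= k / (l - w).
Proof.
  intros Hk0 Hk; apply (lim_norm_le (Rbar_locally p_infty) _ _ _ (laplace_lim x)).
  apply filter_imp with (2 := eventually_nonneg); intros t Ht.
  pose proof (laplace_partial_diff_le k x 0 t ltac:(lra) Hk) as H.
  rewrite laplace_partial_0 in H.
  norm_replace (minus (laplace_partial l t x) zero); [|vec].
  apply Rle_trans with (1 := H); rewrite Rmult_0_r, exp_0.
  rewrite <- (Rmult_1_r (k / (l - w))) at 2; apply Rmult_le_compat_l.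
  - apply Rmult_le_pos; [exact Hk0|apply Rlt_le, Rinv_0_lt_compat; lra].
  - pose proof (exp_pos ((w - l) * t)); lra.
Qed.

Lemma laplace_commute (L : V -> V) x : is_linear L ->
  (forall t z, 0 <= t -> L (T t z) = T t (L z)) -> L (laplace x) = laplace (L x).
Proof.
  intros HL HC; apply (lim_unique (Rbar_locally p_infty) (fun t => laplace_partial l t (L x)));
    [|apply laplace_lim].
  apply filterlim_ext_loc with (fun t => L (laplace_partial l t x)).
  - apply filter_imp with (2 := eventually_nonneg); intros t Ht.
    now apply laplace_partial_commute.
  - apply (lim_linear _ L); [exact HL|apply laplace_lim].
Qed.

Lemma laplace_is_linear : is_linear laplace.
Proof.
  split.
  - intros x y; apply (lim_unique (Rbar_locally p_infty)
      (fun t => laplace_partial l t (plus x y))); [apply laplace_lim|].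
    apply filterlim_ext_loc with (fun t => plus (laplace_partial l t x) (laplace_partial l t y)).
    + apply filter_imp with (2 := eventually_nonneg); intros t Ht.
      symmetry; now apply laplace_partial_plus.
    + apply lim_plus; [exact _| |]; apply laplace_lim.
  - intros r x; symmetry.
    apply (laplace_commute (fun y => scal r y)); [exact (is_linear_scal_r r Rmult_comm)|].
    intros t z Ht; symmetry; exact (linear_scal _ (c0_linear T HT t Ht) r z).
  - exists (M / (l - w) + 1).
    assert (0 <= M / (l - w)).
    { apply Rmult_le_pos; [exact HM|apply Rlt_le, Rinv_0_lt_compat; lra]. }
    split; [lra|]; intros x.
    apply Rle_trans with (M * norm x / (l - w)).
    + apply laplace_norm_le; [apply Rmult_le_pos; [exact HM|apply norm_ge_0]|].
      intros t Ht; specialize (HMw t x Ht); lra.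
    + pose proof (norm_ge_0 x); unfold Rdiv in *; lra.
Qed.

Lemma gen_lim_laplace x : gen_lim T (laplace x) (minus (scal l (laplace x)) x).
Proof.
  apply (gen_lim_of_derive (fun h => scal (exp (l * h))
    (minus (laplace x) (laplace_partial l h x)))).
  - intros h Hh; apply (lim_unique (Rbar_locally p_infty)
      (fun t => T h (laplace_partial l t x))).
    + apply (lim_linear _ (T h)); [now apply (c0_linear T HT)|apply laplace_lim].
    + apply filterlim_ext_loc with
        (fun t => scal (exp (l * h)) (minus (laplace_partial l (t + h) x) (laplace_partial l h x))).
      * apply filter_imp with (2 := eventually_nonneg); intros t Ht.
        symmetry; now apply semigroup_laplace_partial.
      * apply lim_scal; [exact _|]; apply lim_minus; [exact _| |apply filterlim_const].
        refine (filterlim_comp _ _ _ (fun t => t + h) (fun t => laplace_partial l t x) _ _ _ _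
                  (laplace_lim x)).
        intros P [m Hm]; exists m; intros t Ht; apply Hm; lra.
  - replace (minus (scal l (laplace x)) x)
      with (plus (scal (l * exp (l * 0)) (minus (laplace x) (laplace_partial l 0 x)))
             (scal (exp (l * 0)) (minus zero (laplace_integrand l x 0)))).
    2:{ rewrite Rmult_0_r, exp_0, laplace_partial_0, laplace_integrand_0; vec. }
    apply (is_derive_exp_scal l (fun h => minus (laplace x) (laplace_partial l h x))).
    refine (is_derive_minus (V := V) _ _ _ _ _ _ _).
    + exact (is_derive_const (V := V) (laplace x) 0).
    + apply is_derive_laplace_partial.
Qed.

(** The Laplace transform commutes with the semigroup, hence with the generator. *)
Lemma laplace_left_inverse x y : gen_lim T x y -> laplace (minus (scal l x) y) = x.
Proof.
  intros H.
  assert (E : laplace y = minus (scal l (laplace x)) x).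
  { apply (gen_lim_unique T (laplace x)); [|apply gen_lim_laplace].
    apply gen_lim_linear; [apply laplace_is_linear| |exact H].
    intros t z Ht; symmetry; apply laplace_commute; [now apply (c0_linear T HT)|].
    intros s u Hs; now rewrite <- !(c0_add T HT), Rplus_comm by assumption. }
  rewrite (linear_minus _ _ _ laplace_is_linear), (linear_scal _ laplace_is_linear), E; vec.
Qed.

(** Since the resolvent R is bounded, the graph of the generator is the closed set of
    pairs with x = R (l x - y). *)
Lemma gen_lim_closed x y :
  (forall eps, 0 < eps -> exists x' y', gen_lim T x' y' /\
     norm (minus x' x) < eps /\ norm (minus y' y) < eps) ->
  gen_lim T x y.
Proof.
  intros H.
  assert (E : laplace (minus (scal l x) y) = x).
  { destruct (linear_norm _ laplace_is_linear) as [c [Hc Hbd]].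
    apply eq_of_norm_small; intros eps He.
    set (k := c * (Rabs l + 1) + 1).
    assert (Hk : 0 < k).
    { pose proof (Rmult_le_pos c (Rabs l + 1)); pose proof (Rabs_pos l); unfold k; lra. }
    destruct (H (eps / k)) as [x' [y' [Hg [Hx Hy]]]]; [now apply Rdiv_lt_0_compat|].
    rewrite norm_minus_sym.
    norm_replace (plus (minus x x')
      (laplace (minus (scal l (minus x' x)) (minus y' y)))).
    2:{ rewrite <- (laplace_left_inverse x' y' Hg) at 1.
        rewrite !(linear_minus _ _ _ laplace_is_linear), !(linear_scal _ laplace_is_linear),
          !(linear_minus _ _ _ laplace_is_linear); vec. }
    apply Rle_trans with (1 := norm_plus_le _ _).
    rewrite norm_minus_sym.
    pose proof (Hbd (minus (scal l (minus x' x)) (minus y' y))) as H1.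
    pose proof (norm_minus_le (scal l (minus x' x)) (minus y' y)) as H2.
    assert (H3 : norm (scal l (minus x' x)) <= Rabs l * (eps / k)).
    { simpl_norm_scal; apply Rmult_le_compat_l; [apply Rabs_pos|vlra]. }
    assert (H4 : norm (minus (scal l (minus x' x)) (minus y' y)) <= (Rabs l + 1) * (eps / k))
      by vlra.
    apply Rmult_le_compat_l with (r := c) in H4; [|lra].
    replace eps with (eps / k + c * ((Rabs l + 1) * (eps / k))) by (unfold k; field; fold k; lra).
    vlra. }
  pose proof (gen_lim_laplace (minus (scal l x) y)) as Hg; rewrite E in Hg.
  now replace y with (minus (scal l x) (minus (scal l x) y)) by vec.
Qed.

(** The weighted orbit norm sup_t e^{-wt} |T(t) x| is contracted by the factor 1/(l - w)
    under the Laplace transform. It reproduces itself at every step, so that powers cost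
    the constant M only once. *)
Lemma laplace_orbit_norm_le k x : 0 <= k ->
  (forall t, 0 <= t -> norm (T t x) <= k * exp (w * t)) ->
  forall t, 0 <= t -> norm (T t (laplace x)) <= k / (l - w) * exp (w * t).
Proof.
  intros Hk0 Hk t Ht.
  rewrite (laplace_commute (T t)); [|now apply (c0_linear T HT)|].
  2:{ intros s u Hs; now rewrite <- !(c0_add T HT), Rplus_comm by assumption. }
  replace (k / (l - w) * exp (w * t)) with (k * exp (w * t) / (l - w)) by (unfold Rdiv; ring).
  apply laplace_norm_le.
  - apply Rmult_le_pos; [exact Hk0|apply Rlt_le, exp_pos].
  - intros s Hs; rewrite <- (c0_add T HT) by assumption.
    apply Rle_trans with (1 := Hk (s + t) ltac:(lra)); right.
    rewrite Rmult_plus_distr_l, exp_plus; ring.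
Qed.

Lemma laplace_iter_norm_le n x :
  norm (Nat.iter n laplace x) <= M / (l - w) ^ n * norm x.
Proof.
  assert (H : forall t, 0 <= t ->
    norm (T t (Nat.iter n laplace x)) <= M * norm x / (l - w) ^ n * exp (w * t)).
  { induction n as [|n IH]; intros t Ht.
    - simpl; specialize (HMw t x Ht); rewrite Rdiv_1_r; lra.
    - replace (M * norm x / (l - w) ^ S n) with (M * norm x / (l - w) ^ n / (l - w)).
      2:{ simpl; field; split; [apply pow_nonzero|]; lra. }
      apply (laplace_orbit_norm_le (M * norm x / (l - w) ^ n)); [|exact IH|exact Ht].
      apply Rmult_le_pos; [apply Rmult_le_pos; [exact HM|apply norm_ge_0]|].
      apply Rlt_le, Rinv_0_lt_compat, pow_lt; lra. }
  specialize (H 0 (Rle_refl 0)); rewrite (c0_zero T HT), Rmult_0_r, exp_0 in H.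
  unfold Rdiv in *; lra.
Qed.

Lemma is_RInt_gen_laplace x :
  is_RInt_gen (fun t : R => scal (exp (- (t * l))) (T t x))
    (at_point 0) (Rbar_locally p_infty) (laplace x).
Proof.
  intros P HP; pose proof (laplace_lim x P HP) as H; unfold filtermap in H.
  apply (Filter_prod _ _ _ (fun a => a = 0) (fun b => 0 <= b /\ P (laplace_partial l b x))).
  - reflexivity.
  - now apply filter_and; [apply eventually_nonneg|].
  - intros a b -> [Hb HPb]; exists (laplace_partial l b x); split; [|exact HPb].
    apply (is_RInt_ext (laplace_integrand l x)); [|apply is_RInt_laplace].
    intros s Hs; simpl in Hs; rewrite Rmin_left in Hs by exact Hb.
    unfold laplace_integrand; now rewrite Rabs_pos_eq by lra.
Qed.

End Resolvent.
End Semigroup.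
End Semigroups.

(** * Yosida approximations *)

Lemma le_of_le_exp (a b : R) : 0 <= b -> (forall d, 0 < d -> a <= b * exp d) -> a <= b.
Proof.
  intros Hb H; apply le_epsilon; intros eps He.
  assert (He' : 0 < eps / (b + 1)) by (apply Rdiv_lt_0_compat; lra).
  specialize (H (ln (1 + eps / (b + 1)))).
  rewrite exp_ln in H by lra.
  apply Rle_trans with (b * (1 + eps / (b + 1))).
  - apply H; rewrite <- ln_1; apply ln_increasing; lra.
  - replace (b * (1 + eps / (b + 1))) with (b + b * (eps / (b + 1))) by ring.
    apply Rplus_le_compat_l, Rle_trans with ((b + 1) * (eps / (b + 1))).
    + apply Rmult_le_compat_r; lra.
    + right; field; lra.
Qed.

Lemma eventually_INR_gt (r : R) : eventually (fun n => r < INR n).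
Proof.
  destruct (nfloor_ex (Rabs r) (Rabs_pos r)) as [n [_ Hn]].
  exists (S n); intros m Hm; apply le_INR in Hm; rewrite S_INR in Hm.
  pose proof (Rle_abs r); lra.
Qed.

Section Yosida.
Context {V : CompleteNormedModule R_AbsRing}.
Implicit Types (x y z : V).
(* A is an unbounded operator with domain D, and C l stands for (l - A)^{-1}. *)
Context (D : V -> Prop) (A : V -> V) (C : R -> V -> V) (M w : R) (HM : 0 <= M)
  (C_linear : forall l, w < l -> is_linear (C l))
  (C_dom : forall l x, w < l -> D (C l x))
  (C_right : forall l x, w < l -> minus (scal l (C l x)) (A (C l x)) = x)
  (C_left : forall l y, w < l -> D y -> C l (minus (scal l y) (A y)) = y)
  (C_iter : forall n l x, w < l -> norm (Nat.iter n (C l) x) <= M / (l - w) ^ n * norm x)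
  (D_dense : forall x eps, 0 < eps -> exists y, D y /\ norm (minus y x) < eps).

Definition yosida_approx (n : nat) (x : V) : V := scal (INR n) (A (C (INR n) x)).

Lemma op_resolvent l x : w < l -> A (C l x) = minus (scal l (C l x)) x.
Proof.
  intros Hl; rewrite <- (C_right l x Hl) at 3; vec.
Qed.

Lemma resolvent_op l y : w < l -> D y -> C l (A y) = minus (scal l (C l y)) y.
Proof.
  intros Hl Hy; rewrite <- (C_left l y Hl Hy) at 3.
  rewrite (linear_minus _ _ _ (C_linear l Hl)), (linear_scal _ (C_linear l Hl)); vec.
Qed.

Lemma yosida_approx_eq n x : w < INR n ->
  yosida_approx n x = minus (scal (INR n ^ 2) (C (INR n) x)) (scal (INR n) x).
Proof. intros Hn; unfold yosida_approx; rewrite op_resolvent by exact Hn; vec. Qed.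

Lemma yosida_approx_dom n y : w < INR n -> D y ->
  yosida_approx n y = scal (INR n) (C (INR n) (A y)).
Proof.
  intros Hn Hy; unfold yosida_approx; now rewrite op_resolvent, resolvent_op.
Qed.

Lemma yosida_approx_is_linear n : w < INR n -> is_linear (yosida_approx n).
Proof.
  intros Hn.
  apply is_linear_ext with (fun x => plus (scal (INR n ^ 2) (C (INR n) x)) (scal (- INR n) x)).
  { intros x; rewrite yosida_approx_eq by exact Hn; vec. }
  pose proof (is_linear_comp _ _ (C_linear _ Hn) (is_linear_scal_r (INR n ^ 2) Rmult_comm)) as H1.
  pose proof (is_linear_scal_r (V := V) (- INR n) Rmult_comm) as H2.
  exact (is_linear_comp _ _ (is_linear_prod _ _ H1 H2) is_linear_plus).
Qed.

Lemma yosida_approx_commute_resolvent (L : V -> V) n x : w < INR n -> is_linear L ->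
  (forall x, L (C (INR n) x) = C (INR n) (L x)) ->
  L (yosida_approx n x) = yosida_approx n (L x).
Proof.
  intros Hn HL HC; rewrite !yosida_approx_eq by exact Hn.
  now rewrite (linear_minus _ _ _ HL), !(linear_scal _ HL), HC.
Qed.

Lemma resolvent_equation l m x : w < l -> w < m ->
  minus (C m x) (C l x) = scal (l - m) (C l (C m x)).
Proof.
  intros Hl Hm; pose proof (C_left l (C m x) Hl (C_dom m x Hm)) as H.
  rewrite op_resolvent in H by exact Hm.
  replace (minus (scal l (C m x)) (minus (scal m (C m x)) x))
    with (plus (scal (l - m) (C m x)) x) in H by vec.
  rewrite (linear_plus _ (C_linear l Hl)), (linear_scal _ (C_linear l Hl)) in H.
  rewrite <- H at 1; vec.
Qed.

(** The resolvent equation, written for (l, m) and for (m, l). *)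
Lemma resolvent_commute l m x : w < l -> w < m -> C l (C m x) = C m (C l x).
Proof.
  intros Hl Hm; destruct (Req_dec l m) as [->|Hlm]; [reflexivity|].
  pose proof (resolvent_equation l m x Hl Hm) as H1.
  pose proof (resolvent_equation m l x Hm Hl) as H2.
  replace (C l (C m x)) with (scal (/ (l - m)) (scal (l - m) (C l (C m x)))).
  2:{ vec_field; lra. }
  rewrite <- H1; replace (minus (C m x) (C l x)) with (opp (minus (C l x) (C m x))) by vec.
  rewrite H2; vec_field; lra.
Qed.

Lemma yosida_approx_commute n m x : w < INR n -> w < INR m ->
  yosida_approx n (yosida_approx m x) = yosida_approx m (yosida_approx n x).
Proof.
  intros Hn Hm; apply yosida_approx_commute_resolvent; [exact Hm|now apply yosida_approx_is_linear|].
  intros y; symmetry; apply yosida_approx_commute_resolvent; [exact Hn|now apply C_linear|].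
  intros z; now apply resolvent_commute.
Qed.

(** Since n A C_n = n^2 C_n - n, the flow is e^{-nt} times that of n^2 C_n, whose powers
    are controlled by the hypothesis on the powers of the resolvent. *)
Lemma yosida_flow_norm_le n t x : w < INR n -> 0 <= t ->
  norm (exp_flow (yosida_approx n) t x) <= M * exp (t * (INR n * w / (INR n - w))) * norm x.
Proof.
  intros Hn Ht.
  set (B := fun z => scal (INR n ^ 2) (C (INR n) z)).
  pose proof (yosida_approx_is_linear n Hn) as HY.
  pose proof (C_linear _ Hn) as HC.
  assert (HB : is_linear B).
  { exact (is_linear_comp _ _ HC (is_linear_scal_r (INR n ^ 2) Rmult_comm)). }
  assert (E : exp_flow (yosida_approx n) t x = scal (exp (- INR n * t)) (exp_flow B t x)).
  { transitivity (exp_flow (yosida_approx n) t (scal (exp (- INR n * 0)) (exp_flow B 0 x))).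
    { rewrite (exp_flow_0 _ HB), Rmult_0_r, exp_0; f_equal; vec. }
    symmetry; apply (exp_flow_unique _ HY (fun t => scal (exp (- INR n * t)) (exp_flow B t x)) t Ht).
    intros s _; rewrite yosida_approx_eq by exact Hn.
    apply (is_derive_eq _ _ _ _
      (exp_flow_scal_is_derive (C (INR n)) HC (- INR n) (INR n ^ 2) s x)).
    fold B; vec. }
  rewrite E; simpl_norm_scal; rewrite Rabs_pos_eq by apply Rlt_le, exp_pos.
  set (b := INR n ^ 2 / (INR n - w)).
  assert (Hb : 0 <= b).
  { apply Rmult_le_pos; [apply pow2_ge_0|apply Rlt_le, Rinv_0_lt_compat; lra]. }
  assert (HBk : forall k y, norm (Nat.iter k B y) <= M * b ^ k * norm y).
  { intros k y; unfold B; rewrite iter_scal by exact HC; simpl_norm_scal.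
    rewrite Rabs_pos_eq by apply pow_le, pow2_ge_0.
    apply Rle_trans with ((INR n ^ 2) ^ k * (M / (INR n - w) ^ k * norm y)).
    - apply Rmult_le_compat_l; [apply pow_le, pow2_ge_0|now apply C_iter].
    - right; unfold b, Rdiv; rewrite Rpow_mult_distr, pow_inv; ring. }
  pose proof (exp_flow_norm_le B M b HM Hb HBk t x) as H.
  rewrite (Rabs_pos_eq t Ht) in H.
  apply Rmult_le_compat_l with (r := exp (- INR n * t)) in H; [|apply Rlt_le, exp_pos].
  apply Rle_trans with (1 := H); right.
  replace (t * (INR n * w / (INR n - w))) with (- INR n * t + t * b).
  - rewrite exp_plus; ring.
  - unfold b; field; lra.
Qed.

Lemma lt_of_double_abs_lt n : 2 * Rabs w < INR n -> w < INR n.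
Proof. intros Hn; pose proof (Rle_abs w); pose proof (Rabs_pos w); lra. Qed.

(** For n > 2 |w| the growth rate n w / (n - w) is at most 2 |w|. *)
Lemma yosida_flow_norm_le_uniform n t x : 2 * Rabs w < INR n -> 0 <= t ->
  norm (exp_flow (yosida_approx n) t x) <= M * exp (2 * Rabs w * t) * norm x.
Proof.
  intros Hn Ht; pose proof (Rle_abs w) as Hw; pose proof (Rabs_pos w) as Hw0.
  apply Rle_trans with (1 := yosida_flow_norm_le n t x ltac:(lra) Ht).
  apply Rmult_le_compat_r; [apply norm_ge_0|]; apply Rmult_le_compat_l; [exact HM|].
  apply exp_mono; rewrite (Rmult_comm _ t); apply Rmult_le_compat_l; [exact Ht|].
  apply Rmult_le_reg_r with (INR n - w); [lra|].
  replace (INR n * w / (INR n - w) * (INR n - w)) with (INR n * w) by (field; lra).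
  apply Rle_trans with (INR n * Rabs w); [apply Rmult_le_compat_l; lra|].
  replace (INR n * Rabs w) with (2 * Rabs w * (INR n / 2)) by field.
  apply Rmult_le_compat_l; lra.
Qed.

Lemma resolvent_norm_le l x : w < l -> norm (C l x) <= M / (l - w) * norm x.
Proof.
  intros Hl; pose proof (C_iter 1 l x Hl) as H; simpl in H; now rewrite Rmult_1_r in H.
Qed.

Lemma scaled_resolvent_norm_le n x : 2 * Rabs w < INR n ->
  norm (scal (INR n) (C (INR n) x)) <= 2 * M * norm x.
Proof.
  intros Hn; pose proof (lt_of_double_abs_lt n Hn) as Hn'; pose proof (Rle_abs w) as Hw.
  pose proof (Rabs_pos w).
  simpl_norm_scal; rewrite Rabs_pos_eq by apply pos_INR.
  apply Rle_trans with (INR n * (M / (INR n - w) * norm x)).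
  { apply Rmult_le_compat_l; [apply pos_INR|now apply resolvent_norm_le]. }
  rewrite <- Rmult_assoc; apply Rmult_le_compat_r; [apply norm_ge_0|].
  replace (INR n * (M / (INR n - w))) with (M * (INR n / (INR n - w))) by (unfold Rdiv; ring).
  rewrite (Rmult_comm 2); apply Rmult_le_compat_l; [exact HM|].
  apply Rmult_le_reg_r with (INR n - w); [lra|].
  replace (INR n / (INR n - w) * (INR n - w)) with (INR n) by (field; lra).
  lra.
Qed.

(** On D one has n C_n y - y = C_n (A y), of norm O(1/n); boundedness of n C_n extends
    this to the closure of D. *)
Lemma scaled_resolvent_lim x :
  filterlim (fun n => scal (INR n) (C (INR n) x)) eventually (locally x).
Proof.
  apply lim_norm; [exact _|]; intros eps He.
  set (k := 2 * M + 2).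
  assert (Hk : 0 < k) by (unfold k; lra).
  destruct (D_dense x (eps / k)) as [y [Hy Hxy]]; [now apply Rdiv_lt_0_compat|].
  pose proof (Rmult_le_pos _ _ HM (norm_ge_0 (A y))) as HMA.
  assert (Hev := filter_and _ _ (eventually_INR_gt (2 * Rabs w))
     (eventually_INR_gt (w + (M * norm (A y)) / (eps / k)))).
  apply filter_imp with (2 := Hev); intros n [Hn1 Hn2].
  pose proof (lt_of_double_abs_lt n Hn1) as Hn.
  set (S := fun z => scal (INR n) (C (INR n) z)).
  assert (E : minus (S x) x = plus (S (minus x y)) (plus (C (INR n) (A y)) (minus y x))).
  { unfold S; rewrite resolvent_op, (linear_minus _ _ _ (C_linear _ Hn)) by assumption; vec. }
  change (norm (minus (S x) x) < eps); rewrite E.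
  apply Rle_lt_trans with (1 := norm_plus_le _ _).
  pose proof (norm_plus_le (C (INR n) (A y)) (minus y x)) as H1.
  pose proof (scaled_resolvent_norm_le n (minus x y) Hn1) as H2; fold (S (minus x y)) in H2.
  assert (H3 : norm (C (INR n) (A y)) < eps / k).
  { apply Rle_lt_trans with (1 := resolvent_norm_le _ _ Hn).
    apply Rmult_lt_reg_r with (INR n - w); [lra|].
    replace (M / (INR n - w) * norm (A y) * (INR n - w)) with (M * norm (A y)) by (field; lra).
    apply Rmult_lt_reg_l with (/ (eps / k)).
    { apply Rinv_0_lt_compat; now apply Rdiv_lt_0_compat. }
    replace (/ (eps / k) * (eps / k * (INR n - w))) with (INR n - w) by (field; lra).
    unfold Rdiv in Hn2 |- *; lra. }
  rewrite norm_minus_sym in H2.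
  assert (H4 : 2 * M * norm (minus y x) <= 2 * M * (eps / k)).
  { apply Rmult_le_compat_l; lra. }
  replace eps with (2 * M * (eps / k) + (eps / k + eps / k)) by (unfold k; field; unfold k in Hk; lra).
  vlra.
Qed.

Lemma yosida_approx_lim y : D y ->
  filterlim (fun n => yosida_approx n y) eventually (locally (A y)).
Proof.
  intros Hy; apply filterlim_ext_loc with (2 := scaled_resolvent_lim (A y)).
  apply filter_imp with (2 := eventually_INR_gt w); intros n Hn.
  symmetry; now apply yosida_approx_dom.
Qed.

(** Duhamel's principle for v(s) = e^{sA_n} y as an approximate solution of v' = A_m v;
    its defect e^{sA_n} (A_n y - A_m y) has this form because A_n and A_m commute. *)
Lemma yosida_flow_diff_le n m t y :
  2 * Rabs w < INR n -> 2 * Rabs w < INR m -> 0 <= t ->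
  norm (minus (exp_flow (yosida_approx n) t y) (exp_flow (yosida_approx m) t y)) <=
  (M * exp (2 * Rabs w * t)) ^ 2 * norm (minus (yosida_approx n y) (yosida_approx m y)) * t.
Proof.
  intros Hn Hm Ht.
  pose proof (lt_of_double_abs_lt n Hn) as Hn'; pose proof (lt_of_double_abs_lt m Hm) as Hm'.
  pose proof (yosida_approx_is_linear n Hn') as Ln; pose proof (yosida_approx_is_linear m Hm') as Lm.
  set (En := exp_flow (yosida_approx n)); set (Em := exp_flow (yosida_approx m)).
  assert (E0 : En 0 y = y) by (apply exp_flow_0; exact Ln).
  replace (Em t y) with (Em t (En 0 y)) by (now rewrite E0).
  apply (exp_flow_duhamel _ Lm (fun s => En s y)
    (fun s => En s (minus (yosida_approx n y) (yosida_approx m y)))); [exact Ht| |].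
  - intros s _; unfold En.
    assert (Cm : yosida_approx m (exp_flow (yosida_approx n) s y) =
                 exp_flow (yosida_approx n) s (yosida_approx m y)).
    { apply exp_flow_commute; [exact Ln|exact Lm|].
      intros z; now apply yosida_approx_commute. }
    apply is_derive_eq with (exp_flow (yosida_approx n) s (yosida_approx n y)).
    + apply is_derive_exp_flow, Ln.
    + rewrite Cm, (linear_minus _ _ _ (exp_flow_is_linear _ Ln s)); vec.
  - intros s Hs; set (z := minus _ _).
    apply Rle_trans with (1 := yosida_flow_norm_le_uniform m (t - s) (En s z) Hm ltac:(lra)).
    apply Rle_trans with (M * exp (2 * Rabs w * t) * (M * exp (2 * Rabs w * t) * norm z)); [|right; ring].
    assert (Hexp : forall u, 0 <= u <= t -> M * exp (2 * Rabs w * u) <= M * exp (2 * Rabs w * t)).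
    { intros u Hu; apply Rmult_le_compat_l; [exact HM|]; apply exp_mono.
      apply Rmult_le_compat_l; [pose proof (Rabs_pos w)|]; lra. }
    assert (Hpos : forall u, 0 <= M * exp (2 * Rabs w * u)).
    { intros u; apply Rmult_le_pos; [exact HM|apply Rlt_le, exp_pos]. }
    apply Rmult_le_compat; [apply Hpos|apply norm_ge_0|apply Hexp; lra|].
    apply Rle_trans with (1 := yosida_flow_norm_le_uniform n s z Hn ltac:(lra)).
    apply Rmult_le_compat_r; [apply norm_ge_0|apply Hexp; lra].
Qed.

Definition yosida_semigroup (t : R) (x : V) : V :=
  iota (fun y => filterlim (fun n => exp_flow (yosida_approx n) t x) eventually (locally y)).

Lemma yosida_semigroup_lim t x : 0 <= t ->
  filterlim (fun n => exp_flow (yosida_approx n) t x) eventually (locally (yosida_semigroup t x)).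
Proof.
  intros Ht.
  destruct (cauchy_lim eventually (fun n => exp_flow (yosida_approx n) t x)) as [l Hl].
  - intros eps He.
    set (g := M * exp (2 * Rabs w * t)).
    assert (Hg : 0 <= g) by (apply Rmult_le_pos; [exact HM|apply Rlt_le, exp_pos]).
    destruct (D_dense x (eps / 4 / (g + 1))) as [y [Hy Hxy]]; [apply Rdiv_lt_0_compat; lra|].
    set (k := g ^ 2 * t + 1).
    assert (Hgt : 0 <= g ^ 2 * t) by (apply Rmult_le_pos; [apply pow2_ge_0|exact Ht]).
    assert (Hk : 0 < k) by (unfold k; lra).
    assert (Hek : 0 < eps / 4 / k) by (apply Rdiv_lt_0_compat; lra).
    pose proof (proj1 (lim_norm eventually _ _) (yosida_approx_lim y Hy) _ Hek) as HY.
    exists (fun n => 2 * Rabs w < INR n /\ norm (minus (yosida_approx n y) (A y)) < eps / 4 / k).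
    split; [exact (filter_and _ _ (eventually_INR_gt _) HY)|].
    intros n m [Hn Hny] [Hm Hmy].
    pose proof (exp_flow_is_linear _ (yosida_approx_is_linear n (lt_of_double_abs_lt n Hn)) t) as Ln.
    pose proof (exp_flow_is_linear _ (yosida_approx_is_linear m (lt_of_double_abs_lt m Hm)) t) as Lm.
    norm_replace (plus (exp_flow (yosida_approx n) t (minus x y))
      (plus (minus (exp_flow (yosida_approx n) t y) (exp_flow (yosida_approx m) t y))
        (exp_flow (yosida_approx m) t (minus y x)))).
    2:{ rewrite (linear_minus _ _ _ Ln), (linear_minus _ _ _ Lm); vec. }
    pose proof (yosida_flow_norm_le_uniform n t (minus x y) Hn Ht) as H1.
    pose proof (yosida_flow_norm_le_uniform m t (minus y x) Hm Ht) as H2.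
    pose proof (yosida_flow_diff_le n m t y Hn Hm Ht) as H3.
    fold g in H1, H2, H3.
    assert (H4 : norm (minus (yosida_approx n y) (yosida_approx m y)) <= 2 * (eps / 4 / k)).
    { apply Rle_trans with (1 := norm_between _ (A y) _).
      rewrite (norm_minus_sym (A y)); lra. }
    apply Rmult_le_compat_l with (r := g ^ 2 * t) in H4; [|exact Hgt].
    assert (H5 : g ^ 2 * t * (2 * (eps / 4 / k)) <= eps / 2).
    { apply Rle_trans with (k * (2 * (eps / 4 / k))).
      - apply Rmult_le_compat_r; [lra|unfold k; lra].
      - right; field; lra. }
    assert (H6 : g * norm (minus y x) < eps / 4).
    { apply Rle_lt_trans with (g * (eps / 4 / (g + 1))); [apply Rmult_le_compat_l; lra|].
      apply Rlt_le_trans with ((g + 1) * (eps / 4 / (g + 1))).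
      - apply Rmult_lt_compat_r; [apply Rdiv_lt_0_compat|]; lra.
      - right; field; lra. }
    rewrite norm_minus_sym in H1.
    apply Rle_lt_trans with (1 := norm_plus_le _ _).
    pose proof (norm_plus_le
      (minus (exp_flow (yosida_approx n) t y) (exp_flow (yosida_approx m) t y))
      (exp_flow (yosida_approx m) t (minus y x))) as H7.
    replace (g ^ 2 * norm (minus (yosida_approx n y) (yosida_approx m y)) * t)
      with (g ^ 2 * t * norm (minus (yosida_approx n y) (yosida_approx m y))) in H3 by ring.
    vlra.
  - replace (yosida_semigroup t x) with l; [exact Hl|]; symmetry.
    refine (iota_filterlim_locally (F := eventually) _ l Hl).
Qed.

Lemma yosida_semigroup_commute (L : V -> V) t x : is_linear L -> 0 <= t ->
  (forall n x, w < INR n -> L (C (INR n) x) = C (INR n) (L x)) ->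
  L (yosida_semigroup t x) = yosida_semigroup t (L x).
Proof.
  intros HL Ht HC.
  apply (lim_unique eventually (fun n => L (exp_flow (yosida_approx n) t x))).
  - apply (lim_linear _ L); [exact HL|now apply yosida_semigroup_lim].
  - apply filterlim_ext_loc with (2 := yosida_semigroup_lim t (L x) Ht).
    apply filter_imp with (2 := eventually_INR_gt w); intros n Hn.
    symmetry; apply exp_flow_commute; [now apply yosida_approx_is_linear|exact HL|].
    intros z; apply yosida_approx_commute_resolvent; auto.
Qed.

Lemma yosida_semigroup_norm_le t x : 0 <= t ->
  norm (yosida_semigroup t x) <= M * exp (w * t) * norm x.
Proof.
  intros Ht; apply le_of_le_exp.
  { repeat apply Rmult_le_pos; [exact HM|apply Rlt_le, exp_pos|apply norm_ge_0]. }
  intros d Hd.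
  apply (lim_norm_le eventually _ _ _ (yosida_semigroup_lim t x Ht)).
  assert (Hev := filter_and _ _ (eventually_INR_gt w) (eventually_INR_gt (w + t * w ^ 2 / d))).
  apply filter_imp with (2 := Hev); intros n [Hn Hn2].
  apply Rle_trans with (1 := yosida_flow_norm_le n t x Hn Ht).
  replace (M * exp (w * t) * norm x * exp d) with (M * (exp (w * t) * exp d) * norm x) by ring.
  apply Rmult_le_compat_r; [apply norm_ge_0|]; apply Rmult_le_compat_l; [exact HM|].
  rewrite <- exp_plus; apply exp_mono.
  replace (t * (INR n * w / (INR n - w))) with (w * t + t * w ^ 2 / (INR n - w)) by (field; lra).
  apply Rplus_le_compat_l.
  apply Rmult_le_reg_r with (INR n - w); [lra|].
  replace (t * w ^ 2 / (INR n - w) * (INR n - w)) with (t * w ^ 2) by (field; lra).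
  replace (t * w ^ 2) with (d * (t * w ^ 2 / d)) by (field; lra).
  apply Rmult_le_compat_l; lra.
Qed.

Lemma yosida_semigroup_is_linear t : 0 <= t -> is_linear (yosida_semigroup t).
Proof.
  intros Ht; split.
  - intros x y; apply (lim_unique eventually
      (fun n => plus (exp_flow (yosida_approx n) t x) (exp_flow (yosida_approx n) t y))).
    + apply filterlim_ext_loc with (2 := yosida_semigroup_lim t (plus x y) Ht).
      apply filter_imp with (2 := eventually_INR_gt w); intros n Hn.
      exact (linear_plus _ (exp_flow_is_linear _ (yosida_approx_is_linear n Hn) t) x y).
    + apply lim_plus; [exact _| |]; now apply yosida_semigroup_lim.
  - intros r x; symmetry.
    apply (yosida_semigroup_commute (fun z => scal r z));
      [exact (is_linear_scal_r r Rmult_comm)|exact Ht|].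
    intros n y Hn; symmetry; exact (linear_scal _ (C_linear _ Hn) r y).
  - exists (M * exp (w * t) + 1); split.
    + pose proof (Rmult_le_pos _ _ HM (Rlt_le _ _ (exp_pos (w * t)))); lra.
    + intros x; apply Rle_trans with (1 := yosida_semigroup_norm_le t x Ht).
      apply Rmult_le_compat_r; [apply norm_ge_0|lra].
Qed.

Lemma yosida_semigroup_0 x : yosida_semigroup 0 x = x.
Proof.
  apply (lim_unique eventually (fun _ : nat => x)); [|apply filterlim_const].
  apply filterlim_ext_loc with (2 := yosida_semigroup_lim 0 x (Rle_refl 0)).
  apply filter_imp with (2 := eventually_INR_gt w); intros n Hn.
  now apply exp_flow_0, yosida_approx_is_linear.
Qed.

Lemma yosida_semigroup_add t s x : 0 <= t -> 0 <= s ->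
  yosida_semigroup (t + s) x = yosida_semigroup t (yosida_semigroup s x).
Proof.
  intros Ht Hs.
  apply (lim_unique eventually (fun n => exp_flow (yosida_approx n) (t + s) x));
    [apply yosida_semigroup_lim; lra|].
  apply lim_norm; [exact _|]; intros eps He.
  set (g := M * exp (2 * Rabs w * t)).
  assert (Hg : 0 <= g) by (apply Rmult_le_pos; [exact HM|apply Rlt_le, exp_pos]).
  assert (Heg : 0 < eps / 2 / (g + 1)) by (apply Rdiv_lt_0_compat; lra).
  set (y := yosida_semigroup s x).
  pose proof (proj1 (lim_norm eventually _ _) (yosida_semigroup_lim s x Hs) _ Heg) as H1.
  pose proof (proj1 (lim_norm eventually _ _) (yosida_semigroup_lim t y Ht) (eps / 2) ltac:(lra))
    as H2.
  apply filter_imp with (2 := filter_and _ _ (eventually_INR_gt (2 * Rabs w)) (filter_and _ _ H1 H2)).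
  intros n [Hn [Hn1 Hn2]]; fold y in Hn1.
  pose proof (yosida_approx_is_linear n (lt_of_double_abs_lt n Hn)) as Ln.
  rewrite (exp_flow_plus _ Ln) by exact Ht.
  apply Rle_lt_trans with (1 := norm_between _ (exp_flow (yosida_approx n) t y) _).
  rewrite <- (linear_minus _ _ _ (exp_flow_is_linear _ Ln t)).
  pose proof (yosida_flow_norm_le_uniform n t (minus (exp_flow (yosida_approx n) s x) y) Hn Ht) as H3.
  fold g in H3.
  assert (H4 : g * norm (minus (exp_flow (yosida_approx n) s x) y) <= eps / 2).
  { apply Rle_trans with ((g + 1) * (eps / 2 / (g + 1))).
    - apply Rmult_le_compat; try lra; apply norm_ge_0.
    - right; field; lra. }
  vlra.
Qed.

(** On D the velocities A_n e^{sA_n} z are uniformly bounded for small s, and the uniform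
    bounds on the flows extend this from D to the whole space. *)
Lemma yosida_flow_equicontinuous x eps : 0 < eps ->
  exists d, 0 < d <= 1 /\ eventually (fun n => forall s, 0 <= s <= d ->
     norm (minus (exp_flow (yosida_approx n) s x) x) <= eps).
Proof.
  intros He; set (g := M * exp (2 * Rabs w * 1)).
  assert (Hg : 0 <= g) by (apply Rmult_le_pos; [exact HM|apply Rlt_le, exp_pos]).
  assert (Hgs : forall n s z, 2 * Rabs w < INR n -> 0 <= s <= 1 ->
            norm (exp_flow (yosida_approx n) s z) <= g * norm z).
  { intros n s z Hn Hs.
    apply Rle_trans with (1 := yosida_flow_norm_le_uniform n s z Hn ltac:(lra)).
    apply Rmult_le_compat_r; [apply norm_ge_0|]; apply Rmult_le_compat_l; [exact HM|].
    apply exp_mono, Rmult_le_compat_l; [pose proof (Rabs_pos w)|]; lra. }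
  destruct (D_dense x (eps / 2 / (g + 1))) as [z [Hz Hxz]]; [apply Rdiv_lt_0_compat; lra|].
  set (k := g * (norm (A z) + 1) + 1).
  assert (Hk : 0 < k).
  { pose proof (Rmult_le_pos g (norm (A z) + 1) Hg); pose proof (norm_ge_0 (A z)); unfold k; lra. }
  exists (Rmin 1 (eps / 2 / k)); split.
  { split; [apply Rmin_glb_lt; [lra|apply Rdiv_lt_0_compat; lra]|apply Rmin_l]. }
  pose proof (proj1 (lim_norm eventually _ _) (yosida_approx_lim z Hz) 1 Rlt_0_1) as HY.
  apply filter_imp with (2 := filter_and _ _ (eventually_INR_gt (2 * Rabs w)) HY).
  intros n [Hn HnY] s [Hs0 Hs].
  pose proof (Rle_trans _ _ _ Hs (Rmin_l _ _)) as Hs1.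
  pose proof (Rle_trans _ _ _ Hs (Rmin_r _ _)) as Hs2.
  pose proof (yosida_approx_is_linear n (lt_of_double_abs_lt n Hn)) as Ln.
  set (E := exp_flow (yosida_approx n)).
  assert (Hmv : norm (minus (E s z) z) <= k * s).
  { assert (E0 : E 0 z = z) by (apply exp_flow_0, Ln).
    rewrite <- E0 at 2; replace (k * s) with (k * (s - 0)) by ring.
    apply (mean_value_norm_const (fun s => E s z)); [exact Hs0|].
    intros u Hu; exists (E u (yosida_approx n z)); split; [apply is_derive_exp_flow, Ln|].
    apply Rle_trans with (1 := Hgs n u _ Hn ltac:(lra)).
    apply Rle_trans with (g * (norm (A z) + 1)); [|unfold k; lra].
    apply Rmult_le_compat_l; [exact Hg|].
    pose proof (norm_le_minus (yosida_approx n z) (A z)); lra. }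
  assert (Hks : k * s <= eps / 2).
  { apply Rle_trans with (k * (eps / 2 / k)); [apply Rmult_le_compat_l; lra|right; field; lra]. }
  norm_replace (plus (E s (minus x z)) (plus (minus (E s z) z) (minus z x))).
  2:{ unfold E; rewrite (linear_minus _ _ _ (exp_flow_is_linear _ Ln s)); vec. }
  apply Rle_trans with (1 := norm_plus_le _ _).
  pose proof (norm_plus_le (minus (E s z) z) (minus z x)) as H1.
  pose proof (Hgs n s (minus x z) Hn ltac:(lra)) as H2; fold E in H2.
  rewrite (norm_minus_sym x z) in H2.
  assert (H3 : (g + 1) * norm (minus z x) <= eps / 2).
  { apply Rle_trans with ((g + 1) * (eps / 2 / (g + 1))).
    - apply Rmult_le_compat_l; lra.
    - right; field; lra. }
  vlra.
Qed.

Lemma yosida_c0_semigroup : c0_semigroup yosida_semigroup.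
Proof.
  apply (c0_semigroup_of_continuous_at_0 _ M w HM yosida_semigroup_is_linear yosida_semigroup_add
    yosida_semigroup_0 yosida_semigroup_norm_le).
  intros x eps He; destruct (yosida_flow_equicontinuous x eps He) as [d [Hd H]].
  exists d; split; [lra|]; intros s Hs.
  apply (lim_norm_minus_le eventually _ _ _ _ (yosida_semigroup_lim s x ltac:(lra))).
  apply filter_imp with (2 := H); intros n Hn; now apply Hn.
Qed.

(** The estimate |e^{hA_n} z - z - h A z| <= eps h holds with h and n independent of each
    other, so n can tend to infinity before h tends to 0. *)
Lemma gen_lim_yosida_semigroup z : D z -> gen_lim yosida_semigroup z (A z).
Proof.
  intros Hz; apply lim_norm; [exact _|]; intros eps He.
  set (g := M * exp (2 * Rabs w * 1)).
  assert (Hg : 0 <= g) by (apply Rmult_le_pos; [exact HM|apply Rlt_le, exp_pos]).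
  assert (Heg : 0 < eps / 4 / (g + 1)) by (apply Rdiv_lt_0_compat; lra).
  destruct (yosida_flow_equicontinuous (A z) (eps / 4) ltac:(lra)) as [d [Hd Hev]].
  pose proof (proj1 (lim_norm eventually _ _) (yosida_approx_lim z Hz) _ Heg) as HY.
  exists (mkposreal d (proj1 Hd)); intros h Hh Hh0.
  change (Rabs (h - 0) < d) in Hh; rewrite Rminus_0_r, Rabs_pos_eq in Hh by lra.
  assert (Hlim : norm (minus (yosida_semigroup h z) (plus z (scal h (A z)))) <= eps / 2 * h).
  { apply (lim_norm_minus_le eventually _ _ _ _ (yosida_semigroup_lim h z ltac:(lra))).
    apply filter_imp with (2 := filter_and _ _ (eventually_INR_gt (2 * Rabs w))
                                  (filter_and _ _ Hev HY)).
    intros n [Hn [Hn1 Hn2]].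
    pose proof (yosida_approx_is_linear n (lt_of_double_abs_lt n Hn)) as Ln.
    set (E := exp_flow (yosida_approx n)).
    assert (E0 : E 0 z = z) by (apply exp_flow_0, Ln).
    pose (f := fun s => minus (E s z) (scal s (A z))).
    norm_replace (minus (f h) (f 0)).
    2:{ unfold f; rewrite E0; vec. }
    replace (eps / 2 * h) with (eps / 2 * (h - 0)) by ring.
    apply mean_value_norm_const; [lra|].
    intros s Hs; exists (minus (E s (yosida_approx n z)) (A z)); split.
    { refine (is_derive_minus (V := V) _ _ _ _ _ (is_derive_exp_flow _ Ln s z) _).
      apply is_derive_scal_id. }
    apply Rle_trans with (1 := norm_between _ (E s (A z)) _).
    unfold E; rewrite <- (linear_minus _ _ _ (exp_flow_is_linear _ Ln s)).
    specialize (Hn1 s ltac:(lra)).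
    pose proof (yosida_flow_norm_le_uniform n s (minus (yosida_approx n z) (A z)) Hn ltac:(lra)) as H1.
    assert (H2 : M * exp (2 * Rabs w * s) * norm (minus (yosida_approx n z) (A z)) <= eps / 4).
    { apply Rle_trans with ((g + 1) * (eps / 4 / (g + 1))).
      - apply Rmult_le_compat; [|apply norm_ge_0| |lra].
        + apply Rmult_le_pos; [exact HM|apply Rlt_le, exp_pos].
        + apply Rle_trans with g; [|lra].
          apply Rmult_le_compat_l; [exact HM|]; apply exp_mono, Rmult_le_compat_l;
            [pose proof (Rabs_pos w)|]; lra.
      - right; field; lra. }
    vlra. }
  apply Rle_lt_trans with (eps / 2); [|lra].
  norm_replace (scal (/ h) (minus (yosida_semigroup h z) (plus z (scal h (A z))))).
  2:{ vec_field; lra. }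
  simpl_norm_scal; rewrite Rabs_pos_eq by (apply Rlt_le, Rinv_0_lt_compat; lra).
  apply Rmult_le_compat_l with (r := / h) in Hlim; [|apply Rlt_le, Rinv_0_lt_compat; lra].
  replace (/ h * (eps / 2 * h)) with (eps / 2) in Hlim by (field; lra).
  vlra.
Qed.

Lemma yosida_laplace l x : w < l -> laplace yosida_semigroup l x = C l x.
Proof.
  intros Hl; rewrite <- (C_right l x Hl) at 1.
  apply (laplace_left_inverse _ yosida_c0_semigroup M w HM yosida_semigroup_norm_le l Hl).
  now apply gen_lim_yosida_semigroup, C_dom.
Qed.

(** The generator extends A, and for l > w both l - A and l - (generator) are bijective,
    so the extension cannot be proper. *)
Lemma gen_lim_yosida_semigroup_inv x y :
  gen_lim yosida_semigroup x y -> D x /\ A x = y.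
Proof.
  intros H; assert (Hl : w < w + 1) by lra.
  pose proof (laplace_left_inverse _ yosida_c0_semigroup M w HM yosida_semigroup_norm_le _ Hl
                x y H) as E.
  rewrite yosida_laplace in E by exact Hl.
  assert (Dx : D x) by (rewrite <- E; now apply C_dom).
  split; [exact Dx|].
  exact (gen_lim_unique _ x _ _ (gen_lim_yosida_semigroup x Dx) H).
Qed.

End Yosida.

(** * Right linear operators on a bimodule *)

Section Additive.
Context {V : CompleteNormedModule R_AbsRing}.
Implicit Types (x y z : V).

(** For L additive, n (L(rx) - r L(x)) depends only on the fractional part of n r, so it
    stays bounded as n grows. This makes the right action of an element of the algebra
    real linear even when the algebra is not associative. *)
Lemma additive_bounded_is_linear (L : V -> V) (c : R) :
  (forall x y, L (plus x y) = plus (L x) (L y)) ->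
  (forall x, norm (L x) <= c * norm x) -> is_linear L.
Proof.
  intros Hadd Hc.
  assert (L0 : L zero = zero).
  { replace (L zero) with (minus (L (plus zero zero)) (L zero)).
    - replace (plus zero zero) with (zero : V) by vec; vec.
    - rewrite Hadd; vec. }
  assert (Lopp : forall x, L (opp x) = opp (L x)).
  { intros x; replace (L (opp x)) with (minus (L (plus (opp x) x)) (L x)).
    - replace (plus (opp x) x) with (zero : V) by vec; rewrite L0; vec.
    - rewrite Hadd; vec. }
  assert (Ln : forall n x, L (scal (INR n) x) = scal (INR n) (L x)).
  { intros n x; induction n as [|n IH].
    - replace (scal (INR 0) x) with (zero : V) by (simpl; vec); rewrite L0; simpl; vec.
    - rewrite S_INR; replace (scal (INR n + 1) x) with (plus (scal (INR n) x) x) by vec.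
      rewrite Hadd, IH; vec. }
  assert (Lpos : forall r x, 0 <= r -> L (scal r x) = scal r (L x)).
  { intros r x Hr; apply eq_of_norm_small; intros eps He.
    set (k := Rabs c * norm x + norm (L x)).
    assert (Hk : 0 <= k).
    { pose proof (Rmult_le_pos _ _ (Rabs_pos c) (norm_ge_0 x)); pose proof (norm_ge_0 (L x)).
      unfold k; lra. }
    destruct (nfloor_ex (k / eps)) as [n [_ Hn]].
    { apply Rmult_le_pos; [exact Hk|apply Rlt_le, Rinv_0_lt_compat, He]. }
    (* n is so large that an error bounded by k / n is below eps. *)
    set (N := INR (S n)); assert (HN : k / eps < N) by (unfold N; now rewrite S_INR).
    assert (HN0 : 0 < N) by (unfold N; rewrite S_INR; pose proof (pos_INR n); lra).
    destruct (nfloor_ex (N * r)) as [m [Hm1 Hm2]]; [apply Rmult_le_pos; lra|].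
    set (d := N * r - INR m).
    assert (E : scal N (L (scal r x)) = plus (scal (INR m) (L x)) (L (scal d x))).
    { unfold N; rewrite <- !Ln, <- Hadd; f_equal; unfold d, N; vec. }
    assert (E' : scal N (minus (L (scal r x)) (scal r (L x))) = minus (L (scal d x)) (scal d (L x))).
    { transitivity (minus (scal N (L (scal r x))) (scal (N * r) (L x))); [vec|].
      rewrite E; unfold d; vec. }
    assert (HdA : Rabs d <= 1) by (unfold d; rewrite Rabs_pos_eq; lra).
    assert (H1 : N * norm (minus (L (scal r x)) (scal r (L x))) <= k).
    { rewrite <- (Rabs_pos_eq N) at 1 by lra.
      rewrite <- norm_scal_R, E'.
      apply Rle_trans with (1 := norm_minus_le _ _); unfold k; apply Rplus_le_compat.
      - apply Rle_trans with (1 := Hc _); simpl_norm_scal.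
        apply Rle_trans with (Rabs c * (Rabs d * norm x)).
        + apply Rmult_le_compat_r; [|apply Rle_abs].
          apply Rmult_le_pos; [apply Rabs_pos|apply norm_ge_0].
        + apply Rmult_le_compat_l; [apply Rabs_pos|].
          rewrite <- (Rmult_1_l (norm x)) at 2.
          apply Rmult_le_compat_r; [apply norm_ge_0|exact HdA].
      - simpl_norm_scal; rewrite <- (Rmult_1_l (norm (L x))) at 2.
        apply Rmult_le_compat_r; [apply norm_ge_0|exact HdA]. }
    apply Rmult_le_reg_l with N; [exact HN0|].
    apply Rle_trans with (1 := H1).
    apply Rmult_lt_compat_r with (r := eps) in HN; [|exact He].
    replace (k / eps * eps) with k in HN by (field; lra); lra. }
  split; [exact Hadd| |].
  - intros r x; change (L (scal r x) = scal r (L x)).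
    destruct (Rle_lt_dec 0 r) as [Hr|Hr]; [now apply Lpos|].
    replace (scal r x) with (opp (scal (- r) x)) by vec.
    rewrite Lopp, Lpos by lra; vec.
  - exists (Rabs c + 1); split; [pose proof (Rabs_pos c); lra|].
    intros x; apply Rle_trans with (1 := Hc x), Rmult_le_compat_r; [apply norm_ge_0|].
    pose proof (Rle_abs c); lra.
Qed.

End Additive.

Section RealScalars.
Context {K : normed_star_algebra}.

Lemma quadratic_cone_of_real (r : R) : quadratic_cone (of_real r : K).
Proof. left; now exists r. Qed.

Lemma conj_of_real (r : R) : conj (of_real r : K) = of_real r.
Proof. apply sa_conj_real. Qed.

Lemma nm_of_real (r : R) : nm (of_real r : K) = of_real (r * r).
Proof.
  unfold nm; rewrite conj_of_real; unfold of_real.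
  rewrite sa_mul_scal_l, sa_mul_1l; vec.
Qed.

Lemma norm_of_real (r : R) : norm (of_real r : K) = Rabs r.
Proof.
  rewrite (nsa_norm_cone K _ _ (quadratic_cone_of_real r) (nm_of_real r)).
  exact (sqrt_Rsqr_abs r).
Qed.

Lemma twice_re_of_real (r : R) : scal 2 (re (of_real r : K)) = of_real (2 * r).
Proof. unfold re; rewrite conj_of_real; unfold of_real; vec_field. Qed.

End RealScalars.

Section Bimodule.
Context {K : normed_star_algebra} {X : banach_bimodule K}.

Lemma ract_is_linear (a : K) : is_linear (fun u : X => ract u a).
Proof.
  apply (additive_bounded_is_linear _ (norm a)).
  - intros u v; apply bb_ract_plus_l.
  - intros u; apply bb_norm_r.
Qed.

Lemma op_norm_le (B : X -> X) (c : R) : 0 <= c ->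
  (forall u, norm (B u) <= c * norm u) -> Rbar_le (op_norm B) c.
Proof.
  intros Hc H; apply Lub_Rbar_correct; intros r [->|[u [Hu ->]]]; [exact Hc|].
  pose proof (norm_gt_0 u Hu) as Hu0; simpl.
  apply Rmult_le_reg_r with (norm u); [exact Hu0|].
  unfold Rdiv; rewrite Rmult_assoc, Rinv_l, Rmult_1_r by lra; apply H.
Qed.

Lemma norm_le_of_op_norm (B : X -> X) (c : R) : B zero = zero ->
  Rbar_le (op_norm B) c -> forall u, norm (B u) <= c * norm u.
Proof.
  intros B0 H u; destruct (classic (u = zero)) as [->|Hu].
  { rewrite B0, norm_zero_eq; lra. }
  pose proof (norm_gt_0 u Hu) as Hu0.
  assert (H1 : Rbar_le (norm (B u) / norm u) c).
  { apply Rbar_le_trans with (2 := H).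
    apply (proj1 (Lub_Rbar_correct _)); right; now exists u. }
  simpl in H1; apply Rmult_le_compat_r with (r := norm u) in H1; [|lra].
  unfold Rdiv in H1; now rewrite Rmult_assoc, Rinv_l, Rmult_1_r in H1 by lra.
Qed.

Lemma op_norm_is_finite (B : X -> X) (c : R) : 0 <= c ->
  (forall u, norm (B u) <= c * norm u) -> is_finite (op_norm B).
Proof.
  intros Hc H; pose proof (op_norm_le B c Hc H) as H1.
  assert (H0 : Rbar_le 0 (op_norm B)) by (apply (proj1 (Lub_Rbar_correct _)); now left).
  destruct (op_norm B); [reflexivity|destruct H1|destruct H0].
Qed.

Lemma right_linear_zero (A : pmap X) : right_linear A -> dom A zero /\ A zero = zero.
Proof.
  intros [[H0 _] [Hp _]]; split; [exact H0|].
  pose proof (Hp _ _ H0 H0) as H.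
  replace (plus zero zero) with (zero : X) in H by vec.
  replace (A zero) with (minus (plus (A zero) (A zero)) (A zero)) by vec.
  rewrite <- H; vec.
Qed.

Lemma right_linear_scal (A : pmap X) (r : R) x : right_linear A -> dom A x ->
  dom A (scal r x) /\ A (scal r x) = scal r (A x).
Proof.
  intros [[_ [_ [_ Hd]]] [_ Hr]] Hx.
  rewrite <- !bb_real_r; split; [now apply Hd|now apply Hr].
Qed.

Lemma right_linear_minus (A : pmap X) x y : right_linear A -> dom A x -> dom A y ->
  dom A (minus x y) /\ A (minus x y) = minus (A x) (A y).
Proof.
  intros HA Hx Hy; destruct (right_linear_scal A (-1) y HA Hy) as [Hd He].
  replace (minus x y) with (plus x (scal (-1) y)) by vec.
  destruct HA as [[_ [Hp _]] [Hp' _]].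
  split; [now apply Hp|]; rewrite Hp', He by assumption; vec.
Qed.

(** Real scalars act as elements of the algebra, so right linearity contains real
    linearity. *)
Lemma bounded_right_linear_iff (B : X -> X) :
  bounded_right_linear B <->
  is_linear B /\ forall u (a : K), B (ract u a) = ract (B u) a.
Proof.
  split.
  - intros [HB Hf]; destruct (right_linear_zero _ HB) as [_ B0]; simpl in B0.
    split; [split|].
    + intros x y; now apply HB.
    + intros r x; exact (proj2 (right_linear_scal _ r x HB I)).
    + exists (Rabs (real (op_norm B)) + 1); split.
      { pose proof (Rabs_pos (real (op_norm B))); lra. }
      intros x; apply Rle_trans with (real (op_norm B) * norm x).
      * apply norm_le_of_op_norm; [exact B0|].
        unfold is_finite in Hf; rewrite Hf; apply Rbar_le_refl.
      * apply Rmult_le_compat_r; [apply norm_ge_0|].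
        pose proof (Rle_abs (real (op_norm B))); lra.
    + intros u a; now apply HB.
  - intros [HL Hr]; destruct (linear_norm _ HL) as [c [Hc Hb]]; split.
    + split; [repeat split|split]; simpl; intros.
      * exact (linear_plus _ HL u v).
      * apply Hr.
    + apply op_norm_is_finite with c; [lra|exact Hb].
Qed.

Section OperatorExponential.
Context (B : X -> X) (HB : bounded_right_linear B) (t : R).

Lemma exp_flow_bounded_right_linear : bounded_right_linear (exp_flow B t).
Proof.
  apply bounded_right_linear_iff in HB as [HL Hr]; apply bounded_right_linear_iff.
  split; [now apply exp_flow_is_linear|]; intros u a; symmetry.
  apply (exp_flow_commute B HL (fun v => ract v a)); [apply ract_is_linear|].
  intros v; symmetry; apply Hr.
Qed.

Lemma exp_sum_scal N (x : X) :
  sum_n (fun k => scal (/ INR (fact k)) (Nat.iter k (fun z => scal t (B z)) x)) N =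
  exp_partial B t N x.
Proof.
  apply bounded_right_linear_iff in HB as [HL _].
  apply sum_n_ext; intros k; rewrite iter_scal by exact HL; unfold Rdiv; vec.
Qed.

(** The tail of the operator series is dominated, uniformly on the unit ball, by the tail
    of a scalar exponential series. *)
Lemma is_op_exp_exp_flow : is_op_exp (fun z : X => scal t (B z)) (exp_flow B t).
Proof.
  split; [exact exp_flow_bounded_right_linear|]; intros eps He.
  pose proof HB as HB'; apply bounded_right_linear_iff in HB' as [HL _].
  destruct (linear_power_bounded B HL) as [b [Hb Hp]].
  pose proof (proj1 (lim_norm (V := R_CompleteNormedModule) eventually _ _)
                (exp_sum_lim (Rabs t * b)) (eps / 2) ltac:(lra)) as H.
  apply filter_imp with (2 := H); intros N HN.
  change (Rabs (exp_sum (Rabs t * b) N - exp (Rabs t * b)) < eps / 2) in HN.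
  apply Rbar_le_lt_trans with (eps / 2); [|simpl; lra].
  apply op_norm_le; [lra|]; intros u; rewrite exp_sum_scal.
  apply Rle_trans with (1 := exp_flow_tail B 1 b Rle_0_1 Hb Hp t N u).
  apply Rmult_le_compat_r; [apply norm_ge_0|].
  apply Rabs_def2 in HN; lra.
Qed.

Lemma op_exp_eq (x : X) : op_exp (fun z : X => scal t (B z)) x = exp_flow B t x.
Proof.
  apply iota_unique.
  - intros y [E [[HE HEl] ->]].
    apply (lim_unique eventually (fun N => exp_partial B t N x)).
    2:{ apply exp_flow_lim; now apply bounded_right_linear_iff in HB. }
    apply lim_norm; [exact _|]; intros eps He.
    assert (Hk : 0 < norm x + 1) by (pose proof (norm_ge_0 x); lra).
    specialize (HEl (eps / (norm x + 1)) ltac:(now apply Rdiv_lt_0_compat)).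
    apply filter_imp with (2 := HEl); intros N HN.
    assert (H : norm (minus (exp_partial B t N x) (E x)) <= eps / (norm x + 1) * norm x).
    { rewrite <- exp_sum_scal.
      refine (norm_le_of_op_norm _ _ _ (Rbar_lt_le _ _ HN) x).
      pose proof (proj1 (proj1 (bounded_right_linear_iff B) HB)) as HL.
      apply bounded_right_linear_iff in HE as [HE _].
      rewrite exp_sum_scal.
      transitivity (minus zero zero : X); [|vec]; apply f_equal2.
      - exact (linear_zero _ (exp_partial_is_linear B t N HL)).
      - exact (linear_zero _ HE). }
    apply Rle_lt_trans with (1 := H).
    apply Rlt_le_trans with (eps / (norm x + 1) * (norm x + 1)).
    + apply Rmult_lt_compat_l; [now apply Rdiv_lt_0_compat|lra].
    + right; field; lra.
  - exists (exp_flow B t); split; [exact is_op_exp_exp_flow|reflexivity].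
Qed.

End OperatorExponential.
End Bimodule.

(** * The spherical resolvent at real points *)

Section SphericalResolvent.
Context {K : normed_star_algebra} {X : banach_bimodule K}.

Lemma Delta_of_real (A : pmap X) (l : R) x :
  Defs.Delta A (of_real l) x = plus (minus (A (A x)) (scal (2 * l) (A x))) (scal (l ^ 2) x).
Proof.
  unfold Defs.Delta; now rewrite twice_re_of_real, bb_real_l, norm_of_real, pow2_abs.
Qed.

(** Delta_l(A) = (l - A)^2 for real l, domains included. *)
Lemma Delta_of_real_factor (A : pmap X) (l : R) x : right_linear A -> dom_sq A x ->
  let y := minus (scal l x) (A x) in
  dom A y /\ Defs.Delta A (of_real l) x = minus (scal l y) (A y).
Proof.
  intros HA [Hx HAx] y; destruct (right_linear_scal A l x HA Hx) as [Hlx Elx].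
  destruct (right_linear_minus A _ _ HA Hlx HAx) as [Hy Ey].
  split; [exact Hy|].
  assert (Ey' : A y = minus (scal l (A x)) (A (A x))) by (rewrite <- Elx; exact Ey).
  rewrite Delta_of_real, Ey'; unfold y; vec.
Qed.

Lemma Qop_spec (A : pmap X) (a : K) y : sph_resolvent_set A a ->
  dom_sq A (Qop A a y) /\ Defs.Delta A a (Qop A a y) = y.
Proof.
  intros [_ [H _]].
  exact (iota_correct (fun x => dom_sq A x /\ Defs.Delta A a x = y) (H y)).
Qed.

Section Real.
Context (A : pmap X) (HA : right_linear A) (l : R) (Hl : sph_resolvent_set A (of_real l)).

Lemma Qop_linear : is_linear (Qop A (of_real l)).
Proof. destruct Hl as [_ [_ H]]; now apply bounded_right_linear_iff in H. Qed.

Lemma Cop_of_real x : Cop A (of_real l) x =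
  minus (scal l (Qop A (of_real l) x)) (A (Qop A (of_real l) x)).
Proof.
  unfold Cop; rewrite conj_of_real, bb_real_l; now rewrite (linear_scal _ Qop_linear).
Qed.

Lemma Cop_right_inverse x : dom A (Cop A (of_real l) x) /\
  minus (scal l (Cop A (of_real l) x)) (A (Cop A (of_real l) x)) = x.
Proof.
  rewrite Cop_of_real; destruct (Qop_spec A _ x Hl) as [HQ EQ].
  destruct (Delta_of_real_factor A l _ HA HQ) as [Hd Ed].
  split; [exact Hd|]; now rewrite <- Ed.
Qed.

(** C (l y - A y) and y differ by an element of the kernel of l - A; such an element
    belongs to D(A^2) and is killed by Delta_l(A), which is injective. *)
Lemma Cop_left_inverse y : dom A y -> Cop A (of_real l) (minus (scal l y) (A y)) = y.
Proof.
  intros Hy; destruct (Cop_right_inverse (minus (scal l y) (A y))) as [Hz Ez].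
  set (z := Cop A (of_real l) (minus (scal l y) (A y))) in *.
  destruct (right_linear_minus A z y HA Hz Hy) as [Hd Ed].
  set (d := minus z y) in *.
  assert (Ad : A d = scal l d).
  { rewrite Ed; transitivity (minus (minus (scal l z) (minus (scal l z) (A z))) (A y)); [vec|].
    rewrite Ez; unfold d; vec. }
  destruct (right_linear_zero A HA) as [H0 E0].
  destruct (right_linear_scal A l d HA Hd) as [Hld Eld].
  assert (Ed0 : d = (zero : X)).
  { destruct Hl as [_ [Huniq _]]; destruct (Huniq (zero : X)) as [u [_ Hu]].
    transitivity u; [symmetry|]; apply Hu.
    - split; [split; [exact Hd|now rewrite Ad]|].
      rewrite Delta_of_real, Ad, Eld, Ad; vec.
    - split; [split; [exact H0|now rewrite E0]|].
      rewrite Delta_of_real, !E0; vec. }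
  replace z with (plus d y) by (unfold d; vec); rewrite Ed0; vec.
Qed.

Lemma Cop_zero : Cop A (of_real l) zero = zero.
Proof.
  destruct (right_linear_zero A HA) as [H0 E0].
  rewrite <- (Cop_left_inverse zero H0) at 2; f_equal; rewrite E0; vec.
Qed.

Lemma Cop_plus x y :
  Cop A (of_real l) (plus x y) = plus (Cop A (of_real l) x) (Cop A (of_real l) y).
Proof.
  destruct (Cop_right_inverse x) as [Hx Ex]; destruct (Cop_right_inverse y) as [Hy Ey].
  set (x' := Cop A (of_real l) x) in *; set (y' := Cop A (of_real l) y) in *.
  destruct HA as [[_ [Hp _]] [Ep _]].
  rewrite <- (Cop_left_inverse (plus x' y')) by now apply Hp.
  f_equal; rewrite Ep by assumption; rewrite <- Ex, <- Ey; vec.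
Qed.

Lemma Cop_ract x (a : K) : Cop A (of_real l) (ract x a) = ract (Cop A (of_real l) x) a.
Proof.
  destruct (Cop_right_inverse x) as [Hx Ex].
  set (x' := Cop A (of_real l) x) in *.
  destruct HA as [[_ [_ [_ Hr]]] [_ Er]].
  rewrite <- (Cop_left_inverse (ract x' a)) by now apply Hr.
  f_equal; rewrite Er by assumption.
  transitivity (ract (minus (scal l x') (A x')) a); [now rewrite Ex|].
  exact (eq_trans (linear_minus _ (scal l x') (A x') (ract_is_linear a))
    (f_equal (fun v => minus v (ract (A x') a)) (linear_scal _ (ract_is_linear a) l x'))).
Qed.

Lemma Cop_is_linear c : Rbar_le (op_norm (Cop A (of_real l))) (Finite c) ->
  is_linear (Cop A (of_real l)).
Proof.
  intros Hc; apply (additive_bounded_is_linear _ c); [exact Cop_plus|].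
  apply norm_le_of_op_norm; [exact Cop_zero|exact Hc].
Qed.

End Real.

(** If B inverts l - A then B^2 inverts Delta_l(A) = (l - A)^2. *)
Lemma sph_resolvent_set_of_inverse (A : pmap X) (l : R) (B : X -> X) :
  right_linear A -> bounded_right_linear B ->
  (forall x, dom A (B x) /\ minus (scal l (B x)) (A (B x)) = x) ->
  (forall y, dom A y -> B (minus (scal l y) (A y)) = y) ->
  sph_resolvent_set A (of_real l) /\ forall x, Cop A (of_real l) x = B x.
Proof.
  intros HA HB HBr HBl.
  assert (HAB : forall x, A (B x) = minus (scal l (B x)) x).
  { intros x; rewrite <- (proj2 (HBr x)) at 3; vec. }
  assert (Hsq : forall y, dom_sq A (B (B y)) /\ Defs.Delta A (of_real l) (B (B y)) = y).
  { intros y; assert (H : dom_sq A (B (B y))).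
    { split; [apply HBr|]; rewrite HAB.
      apply right_linear_minus; [exact HA|apply right_linear_scal; [exact HA|]|]; apply HBr. }
    split; [exact H|].
    rewrite (proj2 (Delta_of_real_factor A l _ HA H)).
    rewrite (proj2 (HBr (B y))); apply HBr. }
  assert (Huniq : forall x, dom_sq A x -> B (B (Defs.Delta A (of_real l) x)) = x).
  { intros x Hx; destruct (Delta_of_real_factor A l x HA Hx) as [Hd Ed].
    rewrite Ed, HBl by exact Hd; apply HBl, Hx. }
  assert (HQ : forall y, Qop A (of_real l) y = B (B y)).
  { intros y; apply iota_unique; [|apply Hsq].
    intros x [Hx <-]; symmetry; now apply Huniq. }
  pose proof (proj1 (bounded_right_linear_iff B) HB) as [HL Hr].
  assert (HQL : is_linear (Qop A (of_real l))).
  { apply is_linear_ext with (fun x => B (B x)); [intros x; symmetry; apply HQ|].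
    exact (is_linear_comp _ _ HL HL). }
  assert (Hres : sph_resolvent_set A (of_real l)).
  { split; [apply quadratic_cone_of_real|]; split.
    - intros y; exists (B (B y)); split; [apply Hsq|].
      intros x [Hx <-]; now apply Huniq.
    - apply bounded_right_linear_iff; split; [exact HQL|].
      intros u a; now rewrite !HQ, !Hr. }
  split; [exact Hres|]; intros x.
  rewrite (Cop_of_real A l Hres), HQ; apply HBr.
Qed.

End SphericalResolvent.

(** * Generators of right linear semigroups *)

Section Generation.
Context {K : normed_star_algebra} {X : banach_bimodule K}.

Lemma c0_semigroup_of_semigroup (T : R -> X -> X) :
  semigroup T -> strongly_continuous T -> c0_semigroup T.
Proof.
  intros [HT [Hadd H0]] Hc; split; [| |exact H0|exact Hc].
  - intros t Ht; now apply bounded_right_linear_iff, HT.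
  - intros t s x [Ht| <-] [Hs| <-].
    + now apply Hadd.
    + now rewrite Rplus_0_r, H0.
    + now rewrite Rplus_0_l, H0.
    + now rewrite Rplus_0_l, H0.
Qed.

Lemma generator_eq (T : R -> X -> X) x y : gen_lim T x y -> generator T x = y.
Proof.
  intros H; apply iota_unique; [|exact H].
  intros z Hz; exact (gen_lim_unique T x z y Hz H).
Qed.

Lemma generator_spec (T : R -> X -> X) x : dom (generator T) x -> gen_lim T x (generator T x).
Proof. intros [y Hy]; now rewrite (generator_eq T x y Hy). Qed.

Lemma iter_ext {V : Type} (f g : V -> V) n x :
  (forall y, f y = g y) -> Nat.iter n f x = Nat.iter n g x.
Proof.
  intros H; induction n as [|n IH]; [reflexivity|]; simpl; now rewrite H, IH.
Qed.

Section Generator.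
Context (T : R -> X -> X) (HT : c0_semigroup T)
  (Hract : forall t u (a : K), 0 <= t -> T t (ract u a) = ract (T t u) a).

Lemma generator_right_linear : right_linear (generator T).
Proof.
  assert (Hr : forall u y (a : K), gen_lim T u y -> gen_lim T (ract u a) (ract y a)).
  { intros u y a; apply (gen_lim_linear T (fun v => ract v a)); [apply ract_is_linear|].
    intros t z Ht; symmetry; now apply Hract. }
  split; [repeat split|split].
  - destruct (generator_dense T HT zero 1 Rlt_0_1) as [z [y [H _]]].
    exists (scal 0 y); replace (zero : X) with (scal 0 z) by vec.
    now apply gen_lim_scal.
  - intros u v [y Hy] [z Hz]; exists (plus y z); now apply gen_lim_plus.
  - intros u [y Hy]; exists (scal (-1) y); replace (opp u) with (scal (-1) u) by vec.
    now apply gen_lim_scal.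
  - intros u a [y Hy]; exists (ract y a); now apply Hr.
  - intros u v Hu Hv; apply generator_eq, gen_lim_plus; [exact HT| |]; now apply generator_spec.
  - intros u a Hu; apply generator_eq, Hr; now apply generator_spec.
Qed.

Lemma generator_densely_defined : densely_defined (generator T).
Proof.
  intros x eps He; destruct (generator_dense T HT x eps He) as [z [y [H Hz]]].
  exists z; split; [now exists y|exact Hz].
Qed.

Context (M w : R) (HM : 0 <= M)
  (HMw : forall t x, 0 <= t -> norm (T t x) <= M * exp (w * t) * norm x).

(** Translation of [gen_lim_closed] to the product topology, whose balls are compared
    with the norm through [norm_factor]. *)
Lemma generator_closed_graph : closed_graph (generator T).
Proof.
  intros [x y] Hcl; simpl.
  assert (H : gen_lim T x y).
  { apply (gen_lim_closed T HT M w HM HMw (w + 1) ltac:(lra)).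
    intros eps He; apply NNPP; intros Hno; apply Hcl.
    pose proof (norm_factor_gt_0 (V := X)) as Hf.
    assert (Hd : 0 < eps / norm_factor (V := X)) by now apply Rdiv_lt_0_compat.
    exists (mkposreal _ Hd); intros [x' y'] [Hx Hy] [Hdom Hval].
    apply (norm_compat2 (V := X) x x' (mkposreal _ Hd)) in Hx.
    apply (norm_compat2 (V := X) y y' (mkposreal _ Hd)) in Hy.
    simpl in Hdom, Hval, Hx, Hy.
    apply Hno; exists x', y'; split; [rewrite Hval; now apply generator_spec|].
    replace (norm_factor (V := X) * (eps / norm_factor (V := X))) with eps in Hx, Hy
      by (field; lra).
    split; assumption. }
  split; [now exists y|symmetry; now apply generator_eq].
Qed.

Lemma generator_resolvent l : w < l ->
  sph_resolvent_set (generator T) (of_real l) /\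
  forall x, Cop (generator T) (of_real l) x = laplace T l x.
Proof.
  intros Hl; apply sph_resolvent_set_of_inverse.
  - exact generator_right_linear.
  - apply bounded_right_linear_iff; split; [now apply (laplace_is_linear T HT M w)|].
    intros u a; symmetry.
    apply (laplace_commute T HT M w HM HMw l Hl (fun v => ract v a)); [apply ract_is_linear|].
    intros t z Ht; symmetry; now apply Hract.
  - intros x; pose proof (gen_lim_laplace T HT M w HM HMw l Hl x) as H; split; [exact (ex_intro _ _ H)|].
    rewrite (generator_eq _ _ _ H); vec.
  - intros y Hy; apply (laplace_left_inverse T HT M w HM HMw l Hl); now apply generator_spec.
Qed.

End Generator.
End Generation.

(** * The Hille-Yosida theorem for right linear semigroups *)

Theorem theorem4p5 (K : normed_star_algebra) (X : banach_bimodule K) :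
  (* (a) *)
  (forall (A : pmap X) (M w : R),
     right_linear A -> closed_graph A -> densely_defined A ->
     1 < M ->
     (forall l : R, w < l -> sph_resolvent_set A (of_real l)) ->
     (forall (n : nat) (l : R), w < l ->
        Rbar_le (op_norm (Nat.iter n (Cop A (of_real l))))
                (Finite (M / (l - w) ^ n))) ->
     (forall n : nat, (1 <= n)%nat -> w < INR n ->
        (forall x : X, dom A (Cop A (of_real (INR n)) x)) /\
        bounded_right_linear (yosida A n)) /\
     exists T : R -> X -> X,
       (forall (t : R) (x : X), 0 <= t ->
          filterlim (fun n : nat => op_exp (fun z : X => scal t (yosida A n z)) x)
            eventually (locally (T t x))) /\
       semigroup T /\ strongly_continuous T /\
       pmap_eq A (generator T) /\
       (forall t : R, 0 <= t -> Rbar_le (op_norm (T t)) (Finite (M * exp (w * t)))) /\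
       laplace_formula A T w)
  /\
  (* (b) *)
  (forall T : R -> X -> X,
     semigroup T -> strongly_continuous T ->
     exists M w : R,
       1 < M /\
       (forall t : R, 0 <= t -> Rbar_le (op_norm (T t)) (Finite (M * exp (t * w)))) /\
       right_linear (generator T) /\ closed_graph (generator T) /\
       densely_defined (generator T) /\
       (forall l : R, w < l -> sph_resolvent_set (generator T) (of_real l)) /\
       (forall (n : nat) (l : R), w < l ->
          Rbar_le (op_norm (Nat.iter n (Cop (generator T) (of_real l))))
                  (Finite (M / (l - w) ^ n))) /\
       laplace_formula (generator T) T w).
Proof.
  split.
  { intros A M w HA _ HD HM1 Hres Hpow.
    assert (HM : 0 <= M) by lra.
    set (C := fun l => Cop A (of_real l)).
    assert (CL : forall l, w < l -> is_linear (C l)).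
    { intros l Hl; apply (Cop_is_linear A HA l (Hres l Hl) (M / (l - w) ^ 1)), (Hpow 1%nat l Hl). }
    assert (CD : forall l x, w < l -> dom A (C l x)).
    { intros l x Hl; apply (Cop_right_inverse A HA l (Hres l Hl)). }
    assert (CR : forall l x, w < l -> minus (scal l (C l x)) (A (C l x)) = x).
    { intros l x Hl; apply (Cop_right_inverse A HA l (Hres l Hl)). }
    assert (CI : forall l y, w < l -> dom A y -> C l (minus (scal l y) (A y)) = y).
    { intros l y Hl; apply (Cop_left_inverse A HA l (Hres l Hl)). }
    assert (CP : forall n l x, w < l -> norm (Nat.iter n (C l) x) <= M / (l - w) ^ n * norm x).
    { intros n l x Hl; apply norm_le_of_op_norm; [|now apply Hpow].
      exact (linear_zero _ (iter_is_linear _ n (CL l Hl))). }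
    assert (CA : forall l x (a : K), w < l -> ract (C l x) a = C l (ract x a)).
    { intros l x a Hl; symmetry; apply (Cop_ract A HA l (Hres l Hl)). }
    assert (YL : forall n, w < INR n -> bounded_right_linear (yosida A n)).
    { intros n Hn; apply bounded_right_linear_iff; split.
      - exact (yosida_approx_is_linear A C w CL CR n Hn).
      - intros u a; symmetry.
        apply (yosida_approx_commute_resolvent A C w CR (fun v => ract v a) n u Hn
                 (ract_is_linear a)).
        intros x; now apply CA. }
    set (T := yosida_semigroup A C).
    pose proof (yosida_c0_semigroup (dom A) A C M w HM CL CD CR CI CP HD) as HT; fold T in HT.
    assert (TL : forall t x, 0 <= t ->
       filterlim (fun n => exp_flow (yosida A n) t x) eventually (locally (T t x))).
    { exact (yosida_semigroup_lim (dom A) A C M w HM CL CD CR CI CP HD). }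
    assert (TB : forall t x, 0 <= t -> norm (T t x) <= M * exp (w * t) * norm x).
    { exact (yosida_semigroup_norm_le (dom A) A C M w HM CL CD CR CI CP HD). }
    assert (TA : forall t u (a : K), 0 <= t -> T t (ract u a) = ract (T t u) a).
    { intros t u a Ht; symmetry.
      apply (yosida_semigroup_commute (dom A) A C M w HM CL CD CR CI CP HD (fun v => ract v a));
        [apply ract_is_linear|exact Ht|].
      intros n x Hn; now apply CA. }
    split; [intros n _ Hn; split; [intros x; now apply CD|now apply YL]|].
    exists T; split; [|split; [|split; [|split; [|split]]]].
    - intros t x Ht; apply filterlim_ext_loc with (2 := TL t x Ht).
      apply filter_imp with (2 := eventually_INR_gt w); intros n Hn.
      symmetry; now apply op_exp_eq, YL.
    - split; [|split; [intros t s Ht Hs x; apply (c0_add T HT); lra|apply (c0_zero T HT)]].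
      intros t Ht; apply bounded_right_linear_iff; split; [now apply (c0_linear T HT)|].
      intros u a; now apply TA.
    - intros x; apply (c0_continuous T HT).
    - split.
      + intros x; split.
        * intros Hx; exists (A x).
          exact (gen_lim_yosida_semigroup (dom A) A C M w HM CL CD CR CI CP HD x Hx).
        * intros [y Hy].
          apply (gen_lim_yosida_semigroup_inv (dom A) A C M w HM CL CD CR CI CP HD x y Hy).
      + intros x Hx; symmetry; apply generator_eq.
        exact (gen_lim_yosida_semigroup (dom A) A C M w HM CL CD CR CI CP HD x Hx).
    - intros t Ht; apply op_norm_le; [|intros u; now apply TB].
      apply Rmult_le_pos; [exact HM|apply Rlt_le, exp_pos].
    - intros l Hl x.
      change (Cop A (of_real l) x) with (C l x).
      rewrite <- (yosida_laplace (dom A) A C M w HM CL CD CR CI CP HD l x Hl).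
      exact (is_RInt_gen_laplace T HT M w HM TB l Hl x). }
  { intros T HS HC; pose proof (c0_semigroup_of_semigroup T HS HC) as HT.
    assert (TA : forall t u (a : K), 0 <= t -> T t (ract u a) = ract (T t u) a).
    { intros t u a Ht; destruct HS as [HS _]; specialize (HS t Ht).
      now apply bounded_right_linear_iff in HS. }
    destruct (c0_growth_bound T HT) as [M [w [HM1 HMw]]].
    assert (HM : 0 <= M) by lra.
    assert (TB : forall t x, 0 <= t -> norm (T t x) <= M * exp (w * t) * norm x).
    { intros t x Ht; rewrite (Rmult_comm w); now apply HMw. }
    pose proof (generator_resolvent T HT TA M w HM TB) as HR.
    exists M, w; split; [exact HM1|]; split.
    { intros t Ht; apply op_norm_le; [|intros u; now apply HMw].
      apply Rmult_le_pos; [exact HM|apply Rlt_le, exp_pos]. }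
    split; [now apply generator_right_linear|].
    split; [now apply (generator_closed_graph T HT M w)|].
    split; [now apply generator_densely_defined|].
    split; [intros l Hl; now apply HR|].
    split.
    - intros n l Hl; apply op_norm_le.
      + apply Rmult_le_pos; [exact HM|]; apply Rlt_le, Rinv_0_lt_compat, pow_lt; lra.
      + intros u; rewrite (iter_ext _ (laplace T l)) by (now apply HR).
        exact (laplace_iter_norm_le T HT M w HM TB l Hl n u).
    - intros l Hl x; rewrite (proj2 (HR l Hl)).
      exact (is_RInt_gen_laplace T HT M w HM TB l Hl x). }
Qed.
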